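(* For every $\alpha\in(0,\frac{2\pi}{3}]$ and every integer $n\geq 2$, we have $M_b^\|(n,\alpha)\leq 4n-6$; that is, every $\alpha$-bend multigraph on $n$ vertices has at most $4n-6$ edges.
   Context: For $\alpha\in(0,\pi)$, an $\alpha$-bend edge between points $a$ and $c$ is a polyline $(a,b,c)$ with a single bend point $b$ (not on the line $ac$) such that the interior angle of the triangle $abc$ at $b$ equals $\alpha$. An $\alpha$-bend multigraph is a multigraph embedded in the plane (vertices are distinct points; edges pairwise do not cross, meet only at common endpoints, and contain no vertex in their relative interior; parallel edges allowed) in which every edge is an $\alpha$-bend edge. $M_b^\|(n,\alpha)$ is the supremum, over all $n$-element sets $P\subset\mathbb{R}^2$, of the maximum number of edges of an $\alpha$-bend multigraph with vertex set $P$. *)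

(* Defs.v *)
From Stdlib Require Import Reals List.
Import ListNotations.
Open Scope R_scope.

Definition point := (R * R)%type.

Definition dot (u v : point) : R := fst u * fst v + snd u * snd v.
Definition vsub (u v : point) : point := (fst u - fst v, snd u - snd v).
Definition norm (u : point) : R := sqrt (dot u u).

Definition collinear (p q r : point) : Prop :=
  (fst q - fst p) * (snd r - snd p) - (snd q - snd p) * (fst r - fst p) = 0.

Definition angle_at (a b c : point) : R :=
  acos (dot (vsub a b) (vsub c b) / (norm (vsub a b) * norm (vsub c b))).

Definition on_segment (p q x : point) : Prop :=
  exists t, 0 <= t <= 1 /\
    x = ((1 - t) * fst p + t * fst q, (1 - t) * snd p + t * snd q).

(* an edge is a polyline (a, b, c): endpoints a, c, bend point b *)
Record edge := mkEdge { e_a : point; e_b : point; e_c : point }.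

Definition on_edge (e : edge) (x : point) : Prop :=
  on_segment (e_a e) (e_b e) x \/ on_segment (e_b e) (e_c e) x.

Definition is_endpoint (e : edge) (x : point) : Prop := x = e_a e \/ x = e_c e.

Definition alpha_bend_edge (alpha : R) (e : edge) : Prop :=
  e_a e <> e_c e /\ ~ collinear (e_a e) (e_b e) (e_c e) /\
  angle_at (e_a e) (e_b e) (e_c e) = alpha.

Definition alpha_bend_multigraph (alpha : R) (P : list point) (E : list edge) : Prop :=
  NoDup P /\
  (forall e, In e E -> alpha_bend_edge alpha e /\ In (e_a e) P /\ In (e_c e) P) /\
  (forall e v, In e E -> In v P -> on_edge e v -> is_endpoint e v) /\
  (forall i j x, (i < length E)%nat -> (j < length E)%nat -> i <> j ->
     forall d : edge, on_edge (nth i E d) x -> on_edge (nth j E d) x ->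
       is_endpoint (nth i E d) x /\ is_endpoint (nth j E d) x).

(* Main.v *)
Require Import Defs.
From Stdlib Require Import Reals List.
From Stdlib Require Lra Lia Psatz.
From HB Require Import structures.
From mathcomp Require all_boot boolp zify.
Open Scope R_scope.

(**
  Draw the multigraph as a plane straight-line graph whose vertices are the points of [P] and the
  bends, add a maximal set of non-crossing segments, and group the resulting triangles and the outer
  region into classes, two of them being in the same class when they are adjacent along an added
  segment: the classes play the role of the faces of the multigraph.

  Consider a class of [t] triangles, not containing the outer region, whose boundary contains [r]
  bends on their reflex side and [c] bends on their convex side. Being connected, it satisfies
  [t >= 2 (r + c) - 2], and [t] is even; comparing angles,
  [r (2 pi - alpha) + c alpha < t pi]. For [alpha <= 2 pi / 3] these facts imply [3 r + 2 c <= 2 t].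
  For the outer class, connectedness alone gives [3 r + 2 c + 2 <= 2 (t + h)], where [h] is the number
  of sides bounding the outer region.
  With [e] edges, summing over all classes gives [5 e + 2 <= 2 (t + h)], where now [t] is the total
  number of triangles; on the other hand [t + h + 2 <= 2 (n + e)], as one sees by sweeping the
  plane by a line in a generic direction and charging each triangle to its middle vertex and each hull side to an endpoint.
*)

(** The weights 3 and 2 are dictated by the smallest faces. A lens bounded by two convex sides can
    consist of only 2 triangles, so a convex side can carry at most weight 2. The reflex side then
    takes the 3 that makes each edge worth 5, one more than the 4 that its bend adds to the bound on
    [2 (t + h)]. The equality of all bend angles matters for the chevron [c = r = 1]: its two bend
    angles already sum to 2 pi, so the strict angle inequality excludes [t = 2]. Strictness comes
    from the ends of the edges, which also have corners in the class. The threshold 2 pi / 3 is the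
    value for which [2 pi r - (r - c) alpha >= (2 pi / 3) (2 r + c)] when [r >= c]; with [t = 2 u]
    this yields [3 u >= 2 r + c + 1], and adding [u >= r + c - 1] gives exactly [4 u >= 3 r + 2 c].
    The sweep bound is the one-sided form of Euler's formula for a triangulation of [n + e]
    points. *)

Module AlphaBend.

Import Lra Lia Psatz all_boot boolp zify.

Set Implicit Arguments.
Unset Strict Implicit.
Unset Printing Implicit Defensive.
Local Open Scope R_scope.

(** * Segments crossing a triangle *)

(** Twice the signed area of the triangle, positive when it is counterclockwise. *)
Definition det3 (a1 a2 b1 b2 c1 c2 : R) : R :=
  (b1 - a1) * (c2 - a2) - (b2 - a2) * (c1 - a1).

Lemma Rmul_lt0 (a b : R) : a * b < 0 -> (a < 0 /\ 0 < b) \/ (0 < a /\ b < 0).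
Proof.
move=> h; case: (Rtotal_order a 0) => [?|[a0|?]]; [left|rewrite a0 in h; lra|right]; nra.
Qed.

(* The segment [xy] crosses the open segment from the origin to [p], which lies in the triangle
   (0,0), (1,0), (0,1): follow it from the crossing point in the direction in which [x + y] does not increase. *)
Lemma crossing_cevian_half (p1 p2 x1 x2 y1 y2 r : R) (a := p1 * x2 - p2 * x1) (b := p2 * y1 - p1 * y2) :
  0 < p1 -> 0 < p2 -> p1 + p2 <= 1 -> 0 < a -> 0 < b -> 0 < r < 1 ->
  b * x1 + a * y1 = (a + b) * r * p1 -> b * x2 + a * y2 = (a + b) * r * p2 ->
  x1 + x2 <= r * (p1 + p2) ->
  [\/ [/\ 0 < x1, 0 < x2 & x1 + x2 < p1 + p2],
      [/\ x1 < 0, 0 < y1, 0 < x2 * y1 - x1 * y2 & x2 * y1 - x1 * y2 < y1 - x1] |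
      x1 = 0 /\ 0 < x2 < 1].
Proof.
move=> p1_gt0 p2_gt0 pS a_gt0 b_gt0 [r0 r1] e1 e2 xS.
have rP : r * (p1 + p2) < p1 + p2 by nra.
case: (Rtotal_order x1 0) => [x1n|[x10|x1p]].
- have y1p : 0 < y1.
    have h : 0 < a * y1.
      have : 0 < (a + b) * r * p1 by apply: Rmult_lt_0_compat => //; nra.
      nra.
    by nra.
  constructor 2; split=> //.
    have E : p1 * (x2 * y1 - x1 * y2) = (a + b) * r * p1 by rewrite -e1 /a /b; ring.
    have : 0 < (a + b) * r * p1 by apply: Rmult_lt_0_compat => //; nra.
    nra.
  have h1 : 0 < a * y1 + b * x1.
    have : 0 < (a + b) * r * p1 by apply: Rmult_lt_0_compat => //; nra.
    lra.
  have h2 : a * (x2 * y1 - x1 * y2) =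
     (x1 + x2) * (a * y1 + b * x1) - x1 * ((a + b) * (r * (p1 + p2))).
    have -> : (a + b) * (r * (p1 + p2)) = (b * x1 + a * y1) + (b * x2 + a * y2) by rewrite e1 e2; ring.
    ring.
  have h3 : (x1 + x2) * (a * y1 + b * x1) <= (r * (p1 + p2)) * (a * y1 + b * x1) by nra.
  have h4 : a * (x2 * y1 - x1 * y2) <= (r * (p1 + p2)) * (a * (y1 - x1)) by nra.
  have h5 : (r * (p1 + p2)) * (a * (y1 - x1)) < 1 * (a * (y1 - x1)).
    apply: Rmult_lt_compat_r; [nra | lra].
  nra.
- constructor 3; split=> //; rewrite /a x10 in a_gt0; nra.
- constructor 1; split=> //; [|lra].
  by rewrite /a in a_gt0; nra.
Qed.

(** The crossing point is a convex combination of [x] and [y], so one of the two ends has a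
    coordinate sum no larger than the crossing point has. The half lemma applies to that end, with
    the axes exchanged if it is [y]. *)
Lemma crossing_cevian (p1 p2 x1 x2 y1 y2 : R) :
  0 < p1 -> 0 < p2 -> p1 + p2 <= 1 ->
  0 < p1 * x2 - p2 * x1 -> p1 * y2 - p2 * y1 < 0 ->
  det3 x1 x2 y1 y2 0 0 * det3 x1 x2 y1 y2 p1 p2 < 0 ->
  [\/ [/\ 0 < x1, 0 < x2 & x1 + x2 < p1 + p2] \/ [/\ 0 < y1, 0 < y2 & y1 + y2 < p1 + p2],
      [/\ x1 < 0, 0 < y1, 0 < x2 * y1 - x1 * y2 & x2 * y1 - x1 * y2 < y1 - x1],
      [/\ y2 < 0, 0 < x2, 0 < x2 * y1 - x1 * y2 & x2 * y1 - x1 * y2 < x2 - y2] |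
      (x1 = 0 /\ 0 < x2 < 1) \/ (y2 = 0 /\ 0 < y1 < 1)].
Proof.
move=> p1_gt0 p2_gt0 pS a_gt0 b_lt0; rewrite /det3 => hL.
pose a := p1 * x2 - p2 * x1; pose b := p2 * y1 - p1 * y2.
have b_gt0 : 0 < b by rewrite /b; lra.
have a0 : 0 < a by [].
(* The crossing point is [r * p]; [e1] and [e2] write it as the combination of [x] and [y] with
   weights [b] and [a]. *)
pose r := (x2 * y1 - x1 * y2) / (a + b).
have E : x2 * y1 - x1 * y2 = (a + b) * r by rewrite /r; field; lra.
have e1 : b * x1 + a * y1 = (a + b) * r * p1 by rewrite -E /a /b; ring.
have e2 : b * x2 + a * y2 = (a + b) * r * p2 by rewrite -E /a /b; ring.
have hr : 0 < r < 1.
  have : (a + b) * (a + b) * (r * (1 - r)) > 0.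
    have -> : (a + b) * (a + b) * (r * (1 - r)) = ((a + b) * r) * ((a + b) - (a + b) * r) by ring.
    rewrite -E /a /b; nra.
  have : 0 < (a + b) * (a + b) by nra.
  move=> h1 h2; have : 0 < r * (1 - r) by nra.
  by nra.
case: (Rle_lt_dec (x1 + x2) (r * (p1 + p2))) => hx.
- case: (crossing_cevian_half p1_gt0 p2_gt0 pS a0 b_gt0 hr e1 e2 hx) => [h|h|h].
  + by constructor 1; left.
  + by constructor 2.
  + by constructor 4; left.
have hy : y2 + y1 <= r * (p2 + p1).
  have h : a * (y1 + y2) = (a + b) * (r * (p1 + p2)) - b * (x1 + x2) by nra.
  have h2 : b * (x1 + x2) > b * (r * (p1 + p2)) by apply: Rmult_lt_compat_l.
  have h3: a * (y1 + y2) <= a * (r * (p1 + p2)) by nra.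
  have := Rmult_le_reg_l _ _ _ a0 h3; lra.
have e1' : a * y1 + b * x1 = (b + a) * r * p1 by rewrite (Rplus_comm b a) -e1; ring.
have e2' : a * y2 + b * x2 = (b + a) * r * p2 by rewrite (Rplus_comm b a) -e2; ring.
have pS' : p2 + p1 <= 1 by lra.
case: (crossing_cevian_half p2_gt0 p1_gt0 pS' b_gt0 a0 hr e2' e1' hy) => [[? ? ?]|[? ? ? ?]|[? ?]].
- by constructor 1; right; split => //; lra.
- by constructor 3; split => //; nra.
- by constructor 4; right.
Qed.

(* The segment [xy] crosses the open segment from (1,0) to (0,1), [x] on the side of the origin. *)
Lemma crossing_base (x1 x2 y1 y2 : R) :
  x1 + x2 < 1 -> 1 < y1 + y2 ->
  det3 x1 x2 y1 y2 1 0 * det3 x1 x2 y1 y2 0 1 < 0 ->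
  [\/ [/\ 0 <= x1, 0 <= x2 & (x1 = 0 -> x2 = 0 -> 0 < y1 /\ 0 < y2)],
      [/\ x1 < 0, 0 < y1, 0 < x2 * y1 - x1 * y2 & x2 * y1 - x1 * y2 < y1 - x1],
      [/\ x2 < 0, 0 < y2, 0 < x1 * y2 - x2 * y1 & x1 * y2 - x2 * y1 < y2 - x2] |
      [/\ x1 < 0, 0 < y1 & x2 * y1 - x1 * y2 = 0]].
Proof.
move=> hx hy; rewrite /det3 => hL.
pose a := 1 - (x1 + x2); pose b := (y1 + y2) - 1.
have a0 : 0 < a by rewrite /a; lra.
have b0 : 0 < b by rewrite /b; lra.
(* The crossing point is [(b x + a y) / (a + b)]; its coordinates sum to 1 and have a positive
   product, so both are positive. *)
have EL : (b * x1 + a * y1) * (b * x2 + a * y2) > 0 by rewrite /a /b; nra.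
have ES : (b * x1 + a * y1) + (b * x2 + a * y2) = a + b by rewrite /a /b; ring.
have q1 : 0 < b * x1 + a * y1 by nra.
have q2 : 0 < b * x2 + a * y2 by nra.
have bnd1 : a * (x2 * y1 - x1 * y2) = a * (y1 - x1) - a * (b * x1 + a * y1).
  by rewrite /a /b; ring.
have bnd2 : a * (x1 * y2 - x2 * y1) = a * (y2 - x2) - a * (b * x2 + a * y2).
  by rewrite /a /b; ring.
have ha1 : 0 < a * (b * x1 + a * y1) by nra.
have ha2 : 0 < a * (b * x2 + a * y2) by nra.
have B1 : x2 * y1 - x1 * y2 < y1 - x1 by nra.
have B2 : x1 * y2 - x2 * y1 < y2 - x2 by nra.
have K1 : a * (x2 * y1 - x1 * y2) = x2 * (b * x1 + a * y1) - x1 * (b * x2 + a * y2) by ring.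
case: (Rlt_le_dec x1 0) => hx1.
- have y1p : 0 < y1 by nra.
  case: (Rtotal_order 0 (x2 * y1 - x1 * y2)) => [h|[h|h]].
  + by constructor 2.
  + by constructor 4.
  have x2n : x2 < 0.
    case: (Rlt_le_dec x2 0) => // h2; exfalso.
    have : 0 <= x2 * (b * x1 + a * y1) by nra.
    have : 0 <= (-x1) * (b * x2 + a * y2) by nra.
    nra.
  by constructor 3; split=> //; [nra | lra].
case: (Rlt_le_dec x2 0) => hx2.
- constructor 3; split=> //; first nra.
  have : 0 < (- x2) * (b * x1 + a * y1) by nra.
  have : 0 <= x1 * (b * x2 + a * y2) by nra.
  nra.
constructor 1; split=> // x10 x20.
by rewrite x10 x20 in q1 q2; nra.
Qed.

(** * Maximal plane sets of segments *)

Lemma scale_lt0 (d a b : R) : 0 < d -> d * a * (d * b) < 0 <-> a * b < 0.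
Proof.
move=> d0; have d2 : 0 < d * d by apply: Rmult_lt_0_compat.
have -> : d * a * (d * b) = (d * d) * (a * b) by ring.
by move: (a * b) => c; split=> h; nra.
Qed.

Section Drawing.

Variables (V : finType) (X Y : V -> R).

Definition cr (a b c : V) : R := det3 (X a) (Y a) (X b) (Y b) (X c) (Y c).

Definition btw (a b p : V) : Prop :=
  exists s, [/\ 0 < s < 1, X p = X a + s * (X b - X a) & Y p = Y a + s * (Y b - Y a)].

Definition xing (a b c d : V) : Prop := cr a b c * cr a b d < 0 /\ cr c d a * cr c d b < 0.

(** A segment is stored as two opposite darts. Two distinct segments sharing an interior point
    either cross properly or have an end of one inside the other, so the last two clauses leave only
    contacts at common ends. *)
Definition plane_set (T : {set V * V}) : Prop :=
  [/\ forall a b, (a, b) \in T -> (b, a) \in T,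
      forall a, (a, a) \notin T,
      forall a b p, (a, b) \in T -> ~ btw a b p &
      forall a b c d, (a, b) \in T -> (c, d) \in T -> ~ xing a b c d].

Definition in_tri (a b c p : V) : Prop := [/\ 0 <= cr a b p, 0 <= cr b c p & 0 <= cr c a p].

Lemma cr_rot a b c : cr b c a = cr a b c.
Proof. rewrite /cr /det3; ring. Qed.

Lemma cr_opp a b c : cr b a c = - cr a b c.
Proof. rewrite /cr /det3; ring. Qed.

Lemma cr_opp2 a b c : cr a c b = - cr a b c.
Proof. rewrite /cr /det3; ring. Qed.

Lemma crxx a c : cr a a c = 0.
Proof. rewrite /cr /det3; ring. Qed.

Lemma crxyx a c : cr a c a = 0.
Proof. rewrite /cr /det3; ring. Qed.

Lemma crxyy a c : cr a c c = 0.
Proof. rewrite /cr /det3; ring. Qed.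

(** The three-term Plücker relation, the source of the transitivity of turning left. *)
Lemma cr_plucker v a b c d :
  cr v a c * cr v b d = cr v a b * cr v c d + cr v a d * cr v b c.
Proof. rewrite /cr /det3; ring. Qed.

(** Turning left is transitive only within a half-plane; [w] provides one, with [a], [b], [c]
    strictly on the same side of the line [vw]. *)
Lemma cone_trans v a b c :
  0 < cr v a b -> 0 < cr v b c -> forall w, 0 < cr v b w -> 0 < cr v c w -> 0 < cr v a w -> 0 < cr v a c.
Proof.
move=> h1 h2 w h3 h4 h5; have := cr_plucker v a b c w; nra.
Qed.

Lemma btwC a b p : btw a b p -> btw b a p.
Proof. by case=> s [hs ex ey]; exists (1 - s); split; [lra | rewrite ex; ring | rewrite ey; ring]. Qed.

Lemma xingC a b c d : xing a b c d -> xing c d a b.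
Proof. by case=> h1 h2; split. Qed.

Lemma xingN a b c d : xing a b c d -> xing b a c d.
Proof.
case=> h1 h2; split; first by rewrite !(cr_opp a b); lra.
by rewrite Rmult_comm.
Qed.

Section Maximal.

Variable T : {set V * V}.
Hypothesis planeT : plane_set T.
Hypothesis maxT : forall T', plane_set T' -> T \subset T' -> T' = T.

Lemma T_sym a b : (a, b) \in T -> (b, a) \in T.
Proof. by case: planeT => h _ _ _; apply: h. Qed.

Lemma T_irr a b : (a, b) \in T -> a <> b.
Proof. by case: planeT => _ h _ _ abT eab; move: (h a); rewrite {2}eab abT. Qed.

Lemma T_btw a b p : (a, b) \in T -> ~ btw a b p.
Proof. by case: planeT => _ _ h _; apply: h. Qed.

Lemma T_xing a b c d : (a, b) \in T -> (c, d) \in T -> ~ xing a b c d.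
Proof. by case: planeT => _ _ _ h; apply: h. Qed.

(** The point where maximality enters: a segment that can be added is already there. By symmetry it
    suffices to exclude crossing segments whose first end is on the left of [ab]. *)
Lemma T_visible a b : a <> b -> (forall p, ~ btw a b p) ->
  (forall c d, (c, d) \in T -> 0 < cr a b c -> cr a b d < 0 -> cr c d a * cr c d b < 0 -> False) ->
  (a, b) \in T.
Proof.
move=> nab nbtw nx.
have nx' c d : (c, d) \in T -> ~ xing a b c d.
  move=> cdT [h1 h2].
  case: (Rmul_lt0 h1) => -[hc hd]; last exact: (nx c d).
  apply: (nx d c) => //; first exact: T_sym.
  by rewrite !(cr_opp c d); lra.
pose T' := (a, b) |: ((b, a) |: T).
suff <- : T' = T by rewrite !inE eqxx.
apply: maxT; last by apply/subsetP => z zT; rewrite !inE zT !orbT.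
have T'E x y : (x, y) \in T' -> [\/ x = a /\ y = b, x = b /\ y = a | (x, y) \in T].
  rewrite !inE => /orP[/eqP[-> ->]|/orP[/eqP[-> ->]|h]]; by [constructor 1|constructor 2|constructor 3].
have self : ~ xing a b a b by rewrite /xing crxyx; case; lra.
split.
- move=> x y /T'E[[-> ->]|[-> ->]|/T_sym h]; rewrite !inE ?eqxx ?orbT //.
  by rewrite h !orbT.
- move=> x; apply/negP => /T'E[[h1 h2]|[h1 h2]|/T_irr //]; apply: nab; by rewrite -h1 -h2.
- move=> x y p /T'E[[-> ->]|[-> ->]|h]; [exact: nbtw | by move=> /btwC; apply: nbtw | exact: T_btw].
move=> x y z t /T'E[[-> ->]|[-> ->]|h1] /T'E[[-> ->]|[-> ->]|h2].
- exact: self.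
- by move=> /xingC /xingN.
- exact: nx'.
- by move=> /xingN.
- by move=> /xingN /xingC /xingN.
- by move=> /xingN; apply: nx'.
- by move=> /xingC; apply: nx'.
- by move=> /xingC /xingN; apply: nx'.
- exact: T_xing.
Qed.

(** * Affine coordinates attached to a triangle *)

Section Coordinates.
Variables (v u w : V).
Hypothesis D0 : 0 < cr v u w.
Let D := cr v u w.

(** Cramer's rule for the affine frame in which [v], [u], [w] are (0,0), (1,0), (0,1). *)
Definition cox z := cr v z w / D.
Definition coy z := cr v u z / D.

Lemma cx_cr z : cr v z w = D * cox z.
Proof. by rewrite /cox; field; rewrite /D; lra. Qed.

Lemma cy_cr z : cr v u z = D * coy z.
Proof. by rewrite /coy; field; rewrite /D; lra. Qed.

Lemma coxv : cox v = 0. Proof. by rewrite /cox crxx /D; field; lra. Qed.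
Lemma coyv : coy v = 0. Proof. by rewrite /coy crxyx /D; field; lra. Qed.
Lemma coxu : cox u = 1. Proof. by rewrite /cox /D; field; lra. Qed.
Lemma coyu : coy u = 0. Proof. by rewrite /coy crxyy /D; field; lra. Qed.
Lemma coxw : cox w = 0. Proof. by rewrite /cox crxyy /D; field; lra. Qed.
Lemma coyw : coy w = 1. Proof. by rewrite /coy /D; field; lra. Qed.

Lemma cr_coord a b c : cr a b c = D * det3 (cox a) (coy a) (cox b) (coy b) (cox c) (coy c).
Proof.
have D1 : D <> 0 by rewrite /D; lra.
apply: (Rmult_eq_reg_l D) => //.
transitivity (det3 (cr v a w) (cr v u a) (cr v b w) (cr v u b) (cr v c w) (cr v u c)).
  by rewrite /D /cr /det3; ring.
by rewrite !cx_cr !cy_cr /det3; ring.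
Qed.

Lemma X_coord z : X z = X v + cox z * (X u - X v) + coy z * (X w - X v).
Proof.
have D1 : D <> 0 by rewrite /D; lra.
apply: (Rmult_eq_reg_l D) => //.
transitivity (D * X v + (D * cox z) * (X u - X v) + (D * coy z) * (X w - X v)); last by ring.
by rewrite -cx_cr -cy_cr /D /cr /det3; ring.
Qed.

Lemma Y_coord z : Y z = Y v + cox z * (Y u - Y v) + coy z * (Y w - Y v).
Proof.
have D1 : D <> 0 by rewrite /D; lra.
apply: (Rmult_eq_reg_l D) => //.
transitivity (D * Y v + (D * cox z) * (Y u - Y v) + (D * coy z) * (Y w - Y v)); last by ring.
by rewrite -cx_cr -cy_cr /D /cr /det3; ring.
Qed.

Lemma btw_coord a b p s : 0 < s < 1 -> cox p = cox a + s * (cox b - cox a) ->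
  coy p = coy a + s * (coy b - coy a) -> btw a b p.
Proof.
move=> hs ex ey; exists s; split=> //.
  by rewrite (X_coord p) (X_coord a) (X_coord b) ex ey; ring.
by rewrite (Y_coord p) (Y_coord a) (Y_coord b) ex ey; ring.
Qed.

Lemma coord_btw a b p : btw a b p ->
  exists s, [/\ 0 < s < 1, cox p = cox a + s * (cox b - cox a) & coy p = coy a + s * (coy b - coy a)].
Proof.
have D1 : D <> 0 by rewrite /D; lra.
case=> s [hs ex ey]; exists s; split=> //; rewrite /cox /coy /cr /det3 ex ey; field; exact: D1.
Qed.

Lemma in_tri_coord p : in_tri v u w p <-> [/\ 0 <= cox p, 0 <= coy p & cox p + coy p <= 1].
Proof.
have D2 : 0 < D by [].
rewrite /in_tri (cr_coord u w) (cr_coord v u) (cr_coord w v) coxv coyv coxu coyu coxw coyw /det3.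
split=> -[h1 h2 h3]; split; nra.
Qed.

Lemma coord_inj p q : cox p = cox q -> coy p = coy q -> X p = X q /\ Y p = Y q.
Proof. by move=> e1 e2; rewrite (X_coord p) (X_coord q) (Y_coord p) (Y_coord q) e1 e2. Qed.

End Coordinates.

Hypothesis XY_inj : forall p q, X p = X q -> Y p = Y q -> p = q.

(** * Two consecutive segments at a vertex span an empty triangle *)

Section Wedge.
Variables (v u w : V).
Hypothesis D0 : 0 < cr v u w.
Hypotheses (vuT : (v, u) \in T) (vwT : (v, w) \in T).
Hypothesis empty_cone : forall z, (v, z) \in T -> 0 < cr v u z -> 0 < cr v z w -> False.

Let D := cr v u w.
Local Notation cx := (cox v u w).
Local Notation cy := (coy v u w).

Let crE a b c : cr a b c = D * det3 (cx a) (cy a) (cx b) (cy b) (cx c) (cy c).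
Proof. exact: cr_coord D0 a b c. Qed.

Let coordE := (coxv D0, coyv D0, coxu D0, coyu D0, coxw D0, coyw D0).

Lemma wedge_side_w p : cx p = 0 -> 0 < cy p < 1 -> False.
Proof.
move=> h1 h2; apply: (T_btw vwT (p := p)); apply: (btw_coord D0 (s := cy p)) => //.
  by rewrite h1 !coordE; ring.
by rewrite !coordE; ring.
Qed.

Lemma wedge_side_u p : cy p = 0 -> 0 < cx p < 1 -> False.
Proof.
move=> h1 h2; apply: (T_btw vuT (p := p)); apply: (btw_coord D0 (s := cx p)) => //.
  by rewrite !coordE; ring.
by rewrite h1 !coordE; ring.
Qed.

(** The segment [xy] meets the axis [cx = 0] at height [(cy x * cx y - cx x * cy y) / (cx y - cx
    x)], here strictly between 0 and 1, so it crosses [vw]. *)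
Lemma wedge_cross_w x y : (x, y) \in T -> cx x < 0 -> 0 < cx y ->
  0 < cy x * cx y - cx x * cy y -> cy x * cx y - cx x * cy y < cx y - cx x -> False.
Proof.
move=> xyT hx hy k0 k1; apply: (T_xing vwT xyT).
split; rewrite !crE !coordE; apply/(scale_lt0 _ _ D0); rewrite /det3.
  by have := Rmult_lt_0_compat _ _ hy (Ropp_0_gt_lt_contravar _ hx); lra.
have h : 0 < (cy x * cx y - cx x * cy y) * (cx y - cx x - (cy x * cx y - cx x * cy y)).
  by apply: Rmult_lt_0_compat; lra.
by clear -h; lra.
Qed.

Lemma wedge_cross_u x y : (x, y) \in T -> cy x < 0 -> 0 < cy y ->
  0 < cx x * cy y - cy x * cx y -> cx x * cy y - cy x * cx y < cy y - cy x -> False.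
Proof.
move=> xyT hx hy k0 k1; apply: (T_xing vuT xyT).
split; rewrite !crE !coordE; apply/(scale_lt0 _ _ D0); rewrite /det3.
  by have := Rmult_lt_0_compat _ _ hy (Ropp_0_gt_lt_contravar _ hx); lra.
have h : 0 < (cx x * cy y - cy x * cx y) * (cy y - cy x - (cx x * cy y - cy x * cx y)).
  by apply: Rmult_lt_0_compat; lra.
by clear -h; lra.
Qed.

(** Otherwise take [m] in the triangle, not a corner, with [cx + cy] minimal. A vertex on [vm] would
    be lower, and a segment crossing [vm] has a lower end in the triangle or violates planarity at
    [vu] or [vw]. So [vm] is in [T], against the emptiness of the cone. *)
Lemma wedge_empty p : in_tri v u w p -> [\/ p = v, p = u | p = w].
Proof.
pose S := [set p | [&& `[< in_tri v u w p >], p != v, p != u & p != w]].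
move=> hp; case: (boolP (p \in S)) => [pS|]; last first.
  rewrite inE; move/asboolP: (hp) => -> /=; rewrite !negb_and !negbK.
  by case/or3P => /eqP ->; [constructor 1|constructor 2|constructor 3].
have SE z : z \in S -> [/\ 0 < cx z, 0 < cy z, cx z + cy z <= 1 & z <> v].
  rewrite inE => /and4P[/asboolP /(in_tri_coord D0) [h1 h2 h3] /eqP zv /eqP zu /eqP zw].
    have key q : cx z = cx q -> cy z = cy q -> z = q.
    by move=> e1 e2; case: (coord_inj D0 e1 e2); apply: XY_inj.
  have cz1 : 0 < cx z.
    case: (Rle_lt_or_eq_dec _ _ h1) => // e; exfalso.
    case: (Rle_lt_or_eq_dec _ _ h2) => e2.
      case: (Req_dec (cy z) 1) => e3; last by apply: (@wedge_side_w z); lra.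
      by apply: zw; apply: key; rewrite !coordE.
    by apply: zv; apply: key; rewrite !coordE.
  split=> //.
  case: (Rle_lt_or_eq_dec _ _ h2) => // e; exfalso.
  case: (Req_dec (cx z) 1) => e3; last by apply: (@wedge_side_u z); lra.
  by apply: zu; apply: key; rewrite !coordE.
have mkS z : 0 < cx z -> 0 < cy z -> cx z + cy z < 1 -> z \in S.
  move=> h1 h2 h3; rewrite inE; apply/and4P; split.
  - by apply/asboolP/(in_tri_coord D0); split; lra.
  - by apply/eqP => e; move: h1; rewrite e !coordE; lra.
  - by apply/eqP => e; move: h2; rewrite e !coordE; lra.
  - by apply/eqP => e; move: h1; rewrite e !coordE; lra.
exfalso.
(* Counting the lower vertices turns the minimum of a real function into that of a natural one. *)
pose lower z := #|[set t in S | `[< cx t + cy t < cx z + cy z >]]|.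
case: (arg_minnP lower pS) => m mS mmin.
have minm z : z \in S -> cx z + cy z < cx m + cy m -> False.
  move=> zS zm; have := mmin z zS; rewrite leqNgt => /negP; apply.
  apply: proper_card; apply/properP; split.
    apply/subsetP => t; rewrite !inE => /andP[-> /asboolP ht] /=.
    by apply/asboolP; lra.
  exists z; rewrite !inE; first by move: zS; rewrite inE => -> /=; apply/asboolP.
  by rewrite negb_and; apply/orP; right; apply/asboolP; lra.
have [m1 m2 m3 mv] := SE m mS.
have D2 : 0 < D by [].
have vmT : (v, m) \in T.
  apply: T_visible.
  - by move=> e; apply: mv.
  - move=> z hz; case: (coord_btw D0 hz) => s [hs]; rewrite !coordE => ex ey.
    apply: (minm z); last by rewrite ex ey; nra.
    by apply: mkS; nra.
  move=> x y xyT hx hy hL.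
  rewrite !crE !coordE in hx hy hL.
  have hx' : 0 < cx m * cy x - cy m * cx x by move: hx; rewrite /det3; nra.
  have hy' : cx m * cy y - cy m * cx y < 0 by move: hy; rewrite /det3; nra.
  have hL' : det3 (cx x) (cy x) (cx y) (cy y) 0 0 * det3 (cx x) (cy x) (cx y) (cy y) (cx m) (cy m) < 0.
    by move/(scale_lt0 _ _ D0): hL.
  case: (crossing_cevian m1 m2 m3 hx' hy' hL').
  - case=> -[h1 h2 h3].
      by apply: (minm x) => //; apply: mkS => //; lra.
    by apply: (minm y) => //; apply: mkS => //; lra.
  - by case=> h1 h2 h3 h4; apply: (wedge_cross_w xyT).
  - by case=> h1 h2 h3 h4; apply: (wedge_cross_u (T_sym xyT)) => //; lra.
  - by case=> -[h1 h2]; [apply: (@wedge_side_w x) | apply: (@wedge_side_u y)].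
apply: (empty_cone vmT); [rewrite (cy_cr D0) | rewrite (cx_cr D0)]; exact: Rmult_lt_0_compat.
Qed.

(** A segment crossing [uw] starts, on the side of [v], at a vertex of the empty triangle,
    necessarily [v], or crosses [vu] or [vw], or passes through [v]; each is excluded. *)
Lemma wedge_closed : (u, w) \in T.
Proof.
have D2 : 0 < D by [].
apply: T_visible.
- by move=> e; move: D0; rewrite e crxyy; lra.
- move=> p hp; case: (coord_btw D0 hp) => s [hs]; rewrite !coordE => ex ey.
  have : in_tri v u w p by apply/(in_tri_coord D0); split; lra.
  case/wedge_empty => e; move: ex ey; rewrite e !coordE; lra.
move=> x y xyT hx hy hL.
rewrite !crE !coordE in hx hy hL.
have hx' : cx x + cy x < 1 by move: hx; rewrite /det3; nra.
have hy' : 1 < cx y + cy y by move: hy; rewrite /det3; nra.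
have hL' : det3 (cx x) (cy x) (cx y) (cy y) 1 0 * det3 (cx x) (cy x) (cx y) (cy y) 0 1 < 0.
  by move/(scale_lt0 _ _ D0): hL.
case: (crossing_base hx' hy' hL').
- case=> h1 h2 h3.
  have : in_tri v u w x by apply/(in_tri_coord D0); split; lra.
  case/wedge_empty => e; last 2 first.
  + by move: hx'; rewrite e !coordE; lra.
  + by move: hx'; rewrite e !coordE; lra.
  case: h3; rewrite ?e ?coordE // => h3 h4.
  rewrite e in xyT.
  by apply: (empty_cone xyT); [rewrite (cy_cr D0) | rewrite (cx_cr D0)]; apply: Rmult_lt_0_compat; intuition.
- by case=> h1 h2 h3 h4; apply: (wedge_cross_w xyT).
- by case=> h1 h2 h3 h4; apply: (wedge_cross_u xyT).
(* The segment passes through [v], at the parameter where [cx] vanishes. *)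
case=> h1 h2 h3; apply: (T_btw xyT (p := v)).
have h4 : 0 < cx y - cx x by lra.
apply: (btw_coord D0 (s := - cx x / (cx y - cx x))); rewrite ?coordE.
- split; first by apply: Rdiv_lt_0_compat; lra.
  apply: (Rmult_lt_reg_r (cx y - cx x)) => //.
  by rewrite /Rdiv Rmult_assoc Rinv_l; lra.
- by field; lra.
apply: (Rmult_eq_reg_r (cx y - cx x)); last by lra.
have -> : (cy x + - cx x / (cx y - cx x) * (cy y - cy x)) * (cx y - cx x) =
  cy x * cx y - cx x * cy y by field; lra.
by rewrite h3; ring.
Qed.

End Wedge.

Definition face (a b c : V) : Prop :=
  [/\ (a, b) \in T, (b, c) \in T, (c, a) \in T, 0 < cr a b c &
      forall p, in_tri a b c p -> [\/ p = a, p = b | p = c]].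

Lemma face_rot a b c : face a b c -> face b c a.
Proof.
case=> abT bcT caT h e; split=> //; first by rewrite cr_rot.
move=> p [h1 h2 h3]; have hp : in_tri a b c p by [].
by case: (e p hp) => ->; [constructor 3|constructor 1|constructor 2].
Qed.

Lemma wedge_face v u w : 0 < cr v u w -> (v, u) \in T -> (v, w) \in T ->
  (forall z, (v, z) \in T -> 0 < cr v u z -> 0 < cr v z w -> False) -> face v u w.
Proof.
move=> D0 vu vw ec; split=> //.
- exact: (wedge_closed D0 vu vw ec).
- exact: T_sym.
- exact: (wedge_empty D0 vu vw ec).
Qed.

(** A segment entering the corner at [a] either ends inside the empty triangle or crosses the
    opposite side [bc]. *)
Lemma face_cone a b c z : face a b c -> (a, z) \in T -> 0 < cr a b z -> 0 < cr a z c -> False.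
Proof.
case=> abT bcT caT D0 e azT h1 h2.
pose D := cr a b c.
have crE p q r : cr p q r = D * det3 (cox a b c p) (coy a b c p) (cox a b c q) (coy a b c q) (cox a b c r) (coy a b c r).
  exact: cr_coord D0 p q r.
rewrite (cy_cr D0) in h1; rewrite (cx_cr D0) in h2.
have x0 : 0 < cox a b c z by nra.
have y0 : 0 < coy a b c z by nra.
have coordE := (coxv D0, coyv D0, coxu D0, coyu D0, coxw D0, coyw D0).
case: (Rle_lt_dec (cox a b c z + coy a b c z) 1) => hs.
  have : in_tri a b c z by apply/(in_tri_coord D0); split; lra.
  by case/e => ez; move: x0 y0; rewrite ez !coordE; lra.
have p0 : 0 < cox a b c z * coy a b c z by apply: Rmult_lt_0_compat.
apply: (T_xing azT bcT); split; rewrite !crE !coordE; apply/(scale_lt0 _ _ D0); rewrite /det3.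
  by clear -p0; lra.
by clear -hs; lra.
Qed.

Lemma collinear_btw a z z' : cr a z z' = 0 -> z <> z' -> a <> z -> a <> z' ->
  ~ btw z z' a -> btw a z z' \/ btw a z' z.
Proof.
have key b c s : b <> c -> 0 < s -> X c = X a + s * (X b - X a) ->
    Y c = Y a + s * (Y b - Y a) -> btw a b c \/ btw a c b.
  move=> bc s0 ex ey; case: (Rtotal_order s 1) => [s1|[s1|s1]].
  - by left; exists s.
  - by exfalso; apply: bc; apply: XY_inj; rewrite ?ex ?ey s1; ring.
  right; exists (/ s); split.
  - by split; [apply: Rinv_0_lt_compat | rewrite -Rinv_1; apply: Rinv_lt_contravar; lra].
  - by rewrite ex; field; lra.
  - by rewrite ey; field; lra.
rewrite /cr /det3 => h zz' az az' nb.
pose n := (X z - X a) * (X z - X a) + (Y z - Y a) * (Y z - Y a).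
have n0 : 0 < n.
  case: (Req_dec (X z) (X a)) => e1; last first.
    have h1 : X z - X a <> 0 by lra.
    by have := Rlt_0_sqr _ h1; have := Rle_0_sqr (Y z - Y a); rewrite /n /Rsqr; lra.
  case: (Req_dec (Y z) (Y a)) => e2; first by exfalso; apply: az; apply: XY_inj.
  have h2 : Y z - Y a <> 0 by lra.
  by have := Rlt_0_sqr _ h2; have := Rle_0_sqr (X z - X a); rewrite /n /Rsqr; lra.
(* Orthogonal projection gives the position of [z'] on the line from [a] to [z]. *)
pose s := ((X z - X a) * (X z' - X a) + (Y z - Y a) * (Y z' - Y a)) / n.
have ex : X z' = X a + s * (X z - X a).
  apply: (Rmult_eq_reg_l n); last lra.
  have -> : n * (X a + s * (X z - X a)) = n * X a + ((X z - X a) * (X z' - X a) + (Y z - Y a) * (Y z' - Y a)) * (X z - X a).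
    by rewrite /s; field; lra.
  rewrite /n; move: h; move: (X z) (X a) (X z') (Y z) (Y a) (Y z') => x1 x2 x3 y1 y2 y3 h.
  suff : (y1 - y2) * ((x1 - x2) * (y3 - y2) - (y1 - y2) * (x3 - x2)) = 0 by nra.
  by rewrite h; ring.
have ey : Y z' = Y a + s * (Y z - Y a).
  apply: (Rmult_eq_reg_l n); last lra.
  have -> : n * (Y a + s * (Y z - Y a)) = n * Y a + ((X z - X a) * (X z' - X a) + (Y z - Y a) * (Y z' - Y a)) * (Y z - Y a).
    by rewrite /s; field; lra.
  rewrite /n; move: h; move: (X z) (X a) (X z') (Y z) (Y a) (Y z') => x1 x2 x3 y1 y2 y3 h.
  suff : (x1 - x2) * ((x1 - x2) * (y3 - y2) - (y1 - y2) * (x3 - x2)) = 0 by nra.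
  by rewrite h; ring.
case: (Rtotal_order s 0) => [s0|[s0|s0]].
- exfalso; apply: nb; exists (/ (1 - s)); split.
  + by split; [apply: Rinv_0_lt_compat; lra | rewrite -Rinv_1; apply: Rinv_lt_contravar; lra].
  + by rewrite ex; field; lra.
  + by rewrite ey; field; lra.
- by exfalso; apply: az'; apply: XY_inj; rewrite ?ex ?ey s0; ring.
exact: (key _ _ _ zz' s0 ex ey).
Qed.

(** Of two distinct ends on one ray, the nearer would lie inside the segment to the farther;
    [~ btw z z' a] rules out opposite rays. *)
Lemma ray_unique a z z' : (a, z) \in T -> (a, z') \in T -> cr a z z' = 0 ->
  ~ btw z z' a -> z = z'.
Proof.
move=> h1 h2 h3 nb; case: (EM (z = z')) => // zz'; exfalso.
have := collinear_btw h3 zz' (T_irr h1) (T_irr h2) nb.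
by case; apply: T_btw.
Qed.

Lemma side_btw a b z z' : 0 < cr a b z -> 0 < cr a b z' -> ~ btw z z' a.
Proof.
move=> h1 h2 [s [hs ex ey]].
have : (1 - s) * cr a b z + s * cr a b z' = 0 by rewrite /cr /det3 ex ey; ring.
have : 0 < (1 - s) * cr a b z by apply: Rmult_lt_0_compat; lra.
have : 0 < s * cr a b z' by apply: Rmult_lt_0_compat; lra.
lra.
Qed.

(** If the directions of [c] and [c'] from [a] differ, one of them enters the corner of the other
    triangle. *)
Lemma face_unique a b c c' : face a b c -> face a b c' -> c = c'.
Proof.
move=> fc fc'.
have [abT _ caT h _] := fc; have [_ _ caT' h' _] := fc'.
apply: (ray_unique (T_sym caT) (T_sym caT')); last exact: side_btw h h'.
case: (Rtotal_order (cr a c c') 0) => [hn|[//|hp]]; exfalso.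
  apply: (face_cone fc (T_sym caT')) => //; rewrite cr_opp2; lra.
by apply: (face_cone fc' (T_sym caT)).
Qed.

(* The third vertex is the first neighbour of [m] met when turning clockwise from [x]. *)
Lemma face_exists x m x' : (x, m) \in T -> (m, x') \in T -> 0 < cr x m x' ->
  exists z, face x m z.
Proof.
move=> xmT mxT h.
pose S := [set z | ((m, z) \in T) && `[< 0 < cr x m z >]].
pose cone z := #|[set t in S | `[< 0 < cr m z t >]]|.
have x'S : x' \in S by rewrite !inE mxT /=; apply/asboolP.
case: (arg_minnP cone x'S) => u uS umin; exists u.
have : u \in S by [].
rewrite inE => /andP[muT /asboolP hu].
apply: face_rot; apply: face_rot.
apply: wedge_face => //; [by rewrite cr_rot | exact: T_sym |].
move=> z mzT h1 h2.
have h2' : 0 < cr x m z by rewrite -(cr_rot x m).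
have zS : z \in S by rewrite !inE mzT /=; apply/asboolP.
have := umin z zS; rewrite leqNgt => /negP; apply.
apply: proper_card; apply/properP; split.
  apply/subsetP => t; rewrite !inE => /andP[/andP[-> /asboolP ht] /asboolP h3] /=.
  apply/andP; split; first by apply/asboolP.
  apply/asboolP; by apply: (cone_trans h1 h3 (w := x)); rewrite (cr_rot x m).
exists z; rewrite !inE mzT /=; first by apply/andP; split; apply/asboolP.
apply/negP => /andP[_ /asboolP]; rewrite crxyy; lra.
Qed.

End Maximal.
End Drawing.

(** * Darts and the generic sweep *)

Lemma ex_maxR (V : finType) (A : {set V}) (f : V -> R) a :
  a \in A -> exists2 m, m \in A & forall z, z \in A -> f z <= f m.
Proof.
move=> aA; pose above z := #|[set t in A | `[< f z < f t >]]|.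
case: (arg_minnP above aA) => m mA mmin; exists m => // z zA.
case: (Rle_lt_dec (f z) (f m)) => // zm; exfalso.
have := mmin z zA; rewrite leqNgt => /negP; apply.
apply: proper_card; apply/properP; split.
  apply/subsetP => t; rewrite !inE => /andP[-> /asboolP ht] /=.
  by apply/asboolP; lra.
exists z; rewrite !inE; first by rewrite zA /=; apply/asboolP.
by rewrite negb_and; apply/orP; right; apply/asboolP; lra.
Qed.

Section Darts.

Variables (V : finType) (X Y : V -> R) (T : {set V * V}).
Hypothesis planeT : plane_set X Y T.
Hypothesis maxT : forall T', plane_set X Y T' -> T \subset T' -> T' = T.
Hypothesis XY_inj : forall p q, X p = X q -> Y p = Y q -> p = q.
Local Notation cr := (cr X Y).
Local Notation face := (face X Y T).

Definition third (d : V * V) : option V := [pick c | `[< face d.1 d.2 c >]].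

Lemma thirdP a b c : third (a, b) = Some c <-> face a b c.
Proof.
rewrite /third; case: pickP => [c' /asboolP hc' | h].
  split=> [[<-] // | hc]; congr Some.
  exact: face_unique hc' hc.
by split=> // /asboolP hc; have := h c; rewrite hc.
Qed.

Definition tri d : bool := third d.

Lemma triP a b : reflect (exists c, face a b c) (tri (a, b)).
Proof.
rewrite /tri; apply: (iffP idP) => [|[c /thirdP -> //]].
by case E: (third _) => [c|] // _; exists c; apply/thirdP.
Qed.

Lemma tri_T d : tri d -> d \in T.
Proof. by case: d => a b /triP[c []]. Qed.

(** The next dart around the triangle. Darts without a triangle are fixed, which makes [rot] a
    permutation of all pairs. *)
Definition rot d := if third d is Some c then (d.2, c) else d.

Lemma rot_face a b c : face a b c -> rot (a, b) = (b, c).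
Proof. by move=> /thirdP h; rewrite /rot h. Qed.

Lemma rot3 d : rot (rot (rot d)) = d.
Proof.
case: d => a b; case: (boolP (tri (a, b))) => [/triP[c h]|].
  by rewrite (rot_face h) (rot_face (face_rot h)) (rot_face (face_rot (face_rot h))).
by rewrite /tri; case E: (third _) => [//|] _; rewrite /rot !E.
Qed.

Lemma tri_rot d : tri (rot d) = tri d.
Proof.
case: d => a b; case: (boolP (tri (a, b))) => [/triP[c h]|].
  rewrite (rot_face h); apply/triP; exists a; exact: face_rot.
by rewrite /tri; case E: (third _) => [//|] _; rewrite /rot !E.
Qed.

Lemma rot_inj : injective rot.
Proof. by apply: (can_inj (g := fun d => rot (rot d))) => d; exact: rot3. Qed.

Section Sweep.
Variable eps : R.
Definition lin v := X v + eps * Y v.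
Local Notation g := lin.
Hypothesis g_inj : injective g.

(** The linear relation between three plane vectors based at [v], seen through the functional [g]:
    it links the angular order around [v] to the sweep order. *)
Lemma cr_lin v a b c : cr v a b * (g c - g v) + cr v b c * (g a - g v) + cr v c a * (g b - g v) = 0.
Proof. rewrite /lin /cr /det3; ring. Qed.

Lemma lin_btw a b p : btw X Y a b p -> exists s, 0 < s < 1 /\ g p = g a + s * (g b - g a).
Proof. by case=> s [hs ex ey]; exists s; split=> //; rewrite /lin ex ey; ring. Qed.

Definition glt x y : bool := `[< g x < g y >].

Lemma gltP x y : reflect (g x < g y) (glt x y).
Proof. exact: asboolP. Qed.

Lemma glt_total x y : x <> y -> glt x y = ~~ glt y x.
Proof.
move=> xy; have gxy : g x <> g y by move/g_inj.
by case: (gltP x y) => h1; case: (gltP y x) => h2 //; exfalso; lra.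
Qed.

Lemma glt_trans y x z : glt x y -> glt y z -> glt x z.
Proof. move=> /gltP h1 /gltP h2; apply/gltP; lra. Qed.

Definition monotone x y z := (glt x y && glt y z) || (glt z y && glt y x).

(* The dart entering the middle vertex of its triangle; darts with no triangle on their left bound the outer region and are all special. *)
Definition special d : bool := if third d is Some c then monotone d.1 d.2 c else true.

Lemma monotone_one x y z : x <> y -> y <> z -> z <> x ->
  (monotone x y z + monotone y z x + monotone z x y = 1)%N.
Proof.
move=> xy yz zx; rewrite /monotone.
rewrite (glt_total (nesym xy)) (glt_total (nesym yz)) (glt_total (nesym zx)).
have := @glt_trans y x z; have := @glt_trans y z x.
rewrite (glt_total (nesym xy)) (glt_total (nesym yz)) (glt_total (nesym zx)).
by case: (glt x y); case: (glt y z); case: (glt z x) => //= h1 h2; first [by have := h1 isT isT | by have := h2 isT isT].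
Qed.

Lemma face_neq a b c : face a b c -> [/\ a <> b, b <> c & c <> a].
Proof. by case=> h1 h2 h3 _ _; split; apply: T_irr; eassumption. Qed.

Lemma special_one d : tri d -> (special d + special (rot d) + special (rot (rot d)) = 1)%N.
Proof.
case: d => a b /triP[c h]; have h' := face_rot h; have h'' := face_rot h'.
rewrite (rot_face h) (rot_face h') /special.
have /thirdP -> := h; have /thirdP -> := h'; have /thirdP -> := h''.
have [? ? ?] := face_neq h; exact: monotone_one.
Qed.

(** Each triangle has three darts, one of them special, so special darts with a triangle count
    triangles, class by class. *)
Lemma special_third (Q : pred (V * V)) : (forall d, tri d -> Q (rot d) = Q d) ->
  (#|[set d | tri d & Q d]| = 3 * #|[set d | tri d & Q d && special d]|)%N.
Proof.
move=> Qrot; rewrite -!sum1_card !big_mkcond /=.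
pose F d := nat_of_bool (tri d && (Q d && special d)).
transitivity (\sum_d F d + \sum_d F (rot d) + \sum_d F (rot (rot d)))%N.
  rewrite -!big_split /=; apply: eq_bigr => d _; rewrite inE /F !tri_rot.
  case: (boolP (tri d)) => //= td; rewrite !Qrot ?tri_rot //.
  by case: (Q d) => //=; rewrite special_one.
have e1 : (\sum_d F (rot d) = \sum_d F d)%N by rewrite [RHS](reindex_inj rot_inj).
have e2 : (\sum_d F (rot (rot d)) = \sum_d F d)%N.
  by rewrite [RHS](reindex_inj (inj_comp rot_inj rot_inj)).
rewrite e1 e2; have -> : (\sum_d F d = \sum_i (if i \in [set d | tri d & Q d && special d] then 1 else 0))%N.
  by apply: eq_bigr => d _; rewrite inE /F; case: (_ && _).
by rewrite -big_mkcond /= !mulSn mul0n addn0 addnA.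
Qed.

(** The left turn towards [x'] gives [xm] a triangle on its left. As [xm] is special, its third
    vertex [z] lies beyond [m] in the sweep while [x] and [x'] lie before it, so [mx'] would enter
    the corner of that triangle at [m]. The sign [s] covers both sweep directions. *)
Lemma slot_key s x m x' : s = 1 \/ s = -1 -> (x, m) \in T -> (x', m) \in T -> special (x, m) ->
  s * (g x - g m) < 0 -> s * (g x' - g m) < 0 -> 0 < cr x m x' -> False.
Proof.
move=> hs xmT xmT' sp gx gx' h.
have [z hz] := face_exists planeT maxT XY_inj xmT (T_sym planeT xmT') h.
have gz : 0 < s * (g z - g m).
  move: sp; rewrite /special; have /thirdP -> := hz; rewrite /monotone /=.
  by case/orP => /andP[/gltP h1 /gltP h2]; case: hs => es; subst s; lra.
apply: (face_cone planeT (face_rot hz) (T_sym planeT xmT')); last by rewrite cr_rot.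
have [_ _ _ D0 _] := hz.
have D1 : 0 < cr m z x by rewrite cr_rot.
have h' : 0 < cr m x' x by rewrite cr_rot.
have E := cr_lin m z x' x.
have e2 : cr m x z = - cr m z x by exact: cr_opp2.
rewrite e2 in E.
have E' : cr m z x' * (s * (g x - g m)) = - (cr m x' x * (s * (g z - g m))) + cr m z x * (s * (g x' - g m)).
  by nra.
have p1 : 0 < cr m x' x * (s * (g z - g m)) by apply: Rmult_lt_0_compat.
have p2 : cr m z x * (s * (g x' - g m)) < 0 by clear -D1 gx'; nra.
clear -E' p1 p2 gx; nra.
Qed.

(* A special dart is charged to its head, above or below according to the direction of the sweep; the two extreme vertices leave one slot free each. *)
Definition slot (d : V * V) := (d.2, glt d.1 d.2).

Lemma slot_inj : {in [set d in T | special d] &, injective slot}.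
Proof.
move=> [x m] [x' m'] /=; rewrite !inE => /andP[xmT sp] /andP[xmT' sp'] [emm e]; subst m'; congr pair.
have hxm := T_irr planeT xmT; have hxm' := T_irr planeT xmT'.
have [s [hs g1 g2]] : exists s, [/\ s = 1 \/ s = -1, s * (g x - g m) < 0 & s * (g x' - g m) < 0].
  case: (boolP (glt x m)) (e) => [h1|]; rewrite /slot /=.
    move/esym => /gltP h2; move/gltP: h1 => h1; exists 1; split; [by left | lra | lra].
  rewrite -(glt_total (nesym hxm)) => /gltP h1 /esym/negbT; rewrite -(glt_total (nesym hxm')) => /gltP h2.
  by exists (-1); split; [by right | lra | lra].
case: (Rtotal_order (cr x m x') 0) => [h|[h|h]].
- exfalso; apply: (slot_key hs xmT' xmT sp' g2 g1).
  have -> : cr x' m x = - cr x m x' by rewrite -cr_rot cr_opp.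
  lra.
- apply: (ray_unique planeT XY_inj (T_sym planeT xmT) (T_sym planeT xmT')).
    by rewrite cr_opp h; ring.
  case/lin_btw => t [ht]; nra.
by exfalso; apply: (slot_key hs xmT xmT' sp g1 g2).
Qed.

(** The neighbours of an extreme vertex lie in an open half-plane, where turning left orders them by
    angle; the last one in counterclockwise order has no triangle on its left. *)
Lemma extreme_out s m : s = 1 \/ s = -1 -> (exists c, (m, c) \in T) ->
  (forall c, (m, c) \in T -> s * (g c - g m) < 0) ->
  exists2 c, (m, c) \in T & ~~ tri (m, c).
Proof.
move=> hs [c0 mc0] hm.
pose S := [set c | (m, c) \in T].
pose left c := #|[set t in S | `[< 0 < cr m c t >]]|.
have c0S : c0 \in S by rewrite inE.
case: (arg_minnP left c0S) => c cS cmin.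
have : c \in S by [].
rewrite inE => mcT; exists c => //; apply/negP => /triP[z hz].
have [_ _ zmT D0 _] := hz.
have mzT := T_sym planeT zmT.
have zS : z \in S by rewrite inE.
have := cmin z zS; rewrite leqNgt => /negP; apply.
apply: proper_card; apply/properP; split; last first.
  exists z; rewrite !inE mzT /=; first by apply/asboolP.
  by apply/asboolP; rewrite crxyy; lra.
apply/subsetP => t; rewrite !inE => /andP[mtT /asboolP ht]; rewrite mtT /=; apply/asboolP.
have gz := hm _ mzT; have gc := hm _ mcT; have gt := hm _ mtT.
have E := cr_lin m c z t.
have e2 : cr m t c = - cr m c t by exact: cr_opp2.
rewrite e2 in E.
have E' : cr m c t * (s * (g z - g m)) = cr m c z * (s * (g t - g m)) + cr m z t * (s * (g c - g m)) by nra.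
have p1 : cr m c z * (s * (g t - g m)) < 0 by clear -D0 gt; nra.
have p2 : cr m z t * (s * (g c - g m)) < 0 by clear -ht gc; nra.
clear -E' p1 p2 gz; nra.
Qed.

Lemma extreme_in s m : s = 1 \/ s = -1 -> (exists c, (m, c) \in T) ->
  (forall c, (m, c) \in T -> s * (g c - g m) < 0) ->
  exists2 c, (c, m) \in T & ~~ tri (c, m).
Proof.
move=> hs [c0 mc0] hm.
pose S := [set c | (m, c) \in T].
pose right c := #|[set t in S | `[< 0 < cr m t c >]]|.
have c0S : c0 \in S by rewrite inE.
case: (arg_minnP right c0S) => c cS cmin.
have : c \in S by [].
rewrite inE => mcT; exists c; first exact: (T_sym planeT mcT).
apply/negP => /triP[z hz].
have [_ mzT _ D0' _] := hz.
have D0 : 0 < cr m z c by rewrite cr_rot.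
have zS : z \in S by rewrite inE.
have := cmin z zS; rewrite leqNgt => /negP; apply.
apply: proper_card; apply/properP; split; last first.
  exists z; rewrite !inE mzT /=; first by apply/asboolP.
  by apply/asboolP; rewrite crxyy; lra.
apply/subsetP => t; rewrite !inE => /andP[mtT /asboolP ht]; rewrite mtT /=; apply/asboolP.
have gz := hm _ mzT; have gc := hm _ mcT; have gt := hm _ mtT.
have E := cr_lin m t z c.
have e2 : cr m c t = - cr m t c by exact: cr_opp2.
rewrite e2 in E.
have E' : cr m t c * (s * (g z - g m)) = cr m t z * (s * (g c - g m)) + cr m z c * (s * (g t - g m)) by nra.
have p1 : cr m z c * (s * (g t - g m)) < 0 by clear -D0 gt; nra.
have p2 : cr m t z * (s * (g c - g m)) < 0 by clear -ht gc; nra.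
clear -E' p1 p2 gz; nra.
Qed.

Lemma extremes a b : (a, b) \in T -> exists M m, [/\ M <> m, 
  exists c, (M, c) \in T, exists c, (m, c) \in T,
  forall c, (M, c) \in T -> 1 * (g c - g M) < 0 &
  forall c, (m, c) \in T -> -1 * (g c - g m) < 0].
Proof.
(* Extremes are taken among the vertices that carry a segment, so that the hull darts at them
   exist. *)
move=> abT; pose S := [set x | [exists y, (x, y) \in T]].
have inS x y : (x, y) \in T -> x \in S by move=> h; rewrite inE; apply/existsP; exists y.
have [M MS hM] := ex_maxR g (inS _ _ abT).
have [m mS hm] := ex_maxR (fun v => - g v) (inS _ _ abT).
have gneq x y : (x, y) \in T -> g x <> g y by move=> h /g_inj; apply: (T_irr planeT h).
have hM' c : (M, c) \in T -> 1 * (g c - g M) < 0.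
  by move=> h; have := hM _ (inS _ _ (T_sym planeT h)); have := gneq _ _ h; lra.
have hm' c : (m, c) \in T -> -1 * (g c - g m) < 0.
  by move=> h; have := hm _ (inS _ _ (T_sym planeT h)); have := gneq _ _ h; lra.
have eM : exists c, (M, c) \in T by move: MS; rewrite inE => /existsP.
have em : exists c, (m, c) \in T by move: mS; rewrite inE => /existsP.
exists M, m; split=> // e; subst m; case: eM => c h; have := hM' _ h; have := hm' _ h; lra.
Qed.

(** There are two slots per vertex; nothing arrives at the maximum [M] from above or at the minimum
    [m] from below. The left side counts triangles plus hull darts. *)
Lemma special_count a b : (a, b) \in T -> (#|[set d in T | special d]| + 2 <= 2 * #|V|)%N.
Proof.
move=> /extremes[M [m [Mm _ _ hM hm]]].
rewrite -(card_in_imset slot_inj).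
pose U := [set (M, false); (m, true)].
have cU : #|U| = 2%N by rewrite cards2 xpair_eqE andbF.
rewrite -[X in (_ + X <= _)%N]cU -cardsUI (_ : _ :&: U = set0).
  rewrite cards0 addn0; apply: leq_trans (max_card _) _.
  by rewrite card_prod card_bool muln2 mul2n.
apply/setP => q; rewrite !inE; apply/negP => /andP[/imsetP[[x y]]].
rewrite inE => /andP[xyT _] -> {q}; rewrite /slot /=.
have yxT := T_sym planeT xyT.
case/orP => /eqP[] ey; subst y.
  by move/gltP; apply; have := hM _ yxT; lra.
by move/gltP; have := hm _ yxT; lra.
Qed.

End Sweep.
End Darts.

(** * Angles and sums *)

(** Union-find: a new pair lies within a class or fuses two classes, so a class of [k] elements
    always contains at least [k - 1] pairs. *)
Lemma merge_classes (W : finType) (s : seq (W * W)) : exists rep : W -> W,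
  (forall e, e \in s -> rep e.1 = rep e.2) /\
  forall f, (#|[set w | rep w == f]| <= count (fun e => rep e.1 == f) s + 1)%N.
Proof.
elim: s => [|[x y] s [rep [h1 h2]]].
  exists id; split=> // f; rewrite (_ : [set w | _] = [set f]) ?cards1 //.
  by apply/setP => w; rewrite !inE.
case: (eqVneq (rep x) (rep y)) => [e|ne].
  exists rep; split=> [e'|f]; first by rewrite inE => /orP[/eqP -> //|/h1].
  by apply: leq_trans (h2 f) _; rewrite leq_add2r /= leq_addl.
pose rep' w := if rep w == rep y then rep x else rep w.
exists rep'; split=> [e'|f].
  rewrite inE => /orP[/eqP -> /=|/h1 e]; last by rewrite /rep' e.
  by rewrite /rep' eqxx (negbTE ne).
have cnt (P Q : pred (W * W)) : (forall e, P e -> Q e) -> (count P s <= count Q s)%N.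
  by move=> PQ; apply: sub_count.
have rx : rep' x = rep x by rewrite /rep' (negbTE ne).
rewrite /= rx.
case: (eqVneq (rep x) f) => [<-|nf].
  have -> : [set w | rep' w == rep x] = [set w | rep w == rep x] :|: [set w | rep w == rep y].
    apply/setP => w; rewrite !inE /rep'.
    by case: (eqVneq (rep w) (rep y)); rewrite ?eqxx ?orbT ?orbF.
  apply: leq_trans (leq_card_setU _ _) _.
  have := leq_add (h2 (rep x)) (h2 (rep y)).
  set c := count (fun e => rep' e.1 == _) s.
  (* The fused classes were disjoint, so their pairs add up; the new pair pays for one of the two
     units. *)
  suff : (count (fun e => rep e.1 == rep x) s + count (fun e => rep e.1 == rep y) s <= c)%N by lia.
  rewrite -count_predUI (_ : count (predI _ _) s = 0%N); last first.
    apply/eqP; rewrite -leqn0 leqNgt -has_count; apply/hasPn => e _ /=.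
    by apply/negP => /andP[/eqP -> /eqP ex]; move: ne; rewrite ex eqxx.
  rewrite addn0; apply: cnt => e /=; rewrite /rep'.
  by case: (eqVneq (rep e.1) (rep y)); rewrite ?eqxx ?orbT ?orbF.
rewrite add0n; case: (eqVneq f (rep y)) => [ef|nfy].
  rewrite (_ : [set w | _] = set0) ?cards0 //.
  apply/setP => w; rewrite !inE /rep'; case: (eqVneq (rep w) (rep y)) => [_|]; first exact: negbTE.
  by rewrite ef => /negbTE.
have re w : (rep' w == f) = (rep w == f).
  rewrite /rep'; case: (eqVneq (rep w) (rep y)) => [->|//].
  by rewrite (negbTE nf) eq_sym (negbTE nfy).
rewrite (eq_count (a2 := fun e => rep e.1 == f)); last by move=> e; exact: re.
by rewrite (_ : [set w | _] = [set w | rep w == f]) //; apply/setP => w; rewrite !inE re.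
Qed.

HB.instance Definition _ := Monoid.isComLaw.Build R 0 Rplus
  (fun x y z => esym (Rplus_assoc x y z)) Rplus_comm Rplus_0_l.

Local Notation "\rsum_ ( i | P ) F" := (\big[Rplus/0]_(i | P) F)
  (at level 41, i at level 50, F at level 41).

Lemma rsum_ge0 (I : finType) (P : pred I) (F : I -> R) :
  (forall i, P i -> 0 <= F i) -> 0 <= \rsum_(i | P i) F i.
Proof. by move=> h; apply: (big_ind (fun x => 0 <= x)) => [|x y|//]; lra. Qed.

Lemma rsum_le (I : finType) (P : pred I) (F G : I -> R) :
  (forall i, P i -> F i <= G i) -> \rsum_(i | P i) F i <= \rsum_(i | P i) G i.
Proof. by move=> h; apply: (big_ind2 (fun x y => x <= y)) => [|x y z t|//]; lra. Qed.

Lemma rsum_subset (I : finType) (P Q : pred I) (F : I -> R) :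
  (forall i, 0 <= F i) -> (forall i, P i -> Q i) ->
  \rsum_(i | P i) F i <= \rsum_(i | Q i) F i.
Proof.
move=> F0 PQ; rewrite [X in _ <= X](bigID P) /=.
rewrite [X in _ <= X + _](eq_bigl P); last by move=> i; case: (boolP (P i)) => [/PQ ->|]; rewrite ?andbF.
have := @rsum_ge0 _ (fun i => Q i && ~~ P i) F (fun i _ => F0 i); lra.
Qed.

Lemma rsum_disjoint (I : finType) (P P' Q : pred I) (F : I -> R) :
  (forall i, 0 <= F i) -> (forall i, P i -> Q i) -> (forall i, P' i -> Q i) ->
  (forall i, P i -> P' i -> False) ->
  \rsum_(i | P i) F i + \rsum_(i | P' i) F i <= \rsum_(i | Q i) F i.
Proof.
move=> F0 PQ PQ' dis; rewrite [X in _ <= X](bigID P) /=.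
rewrite [X in _ <= X + _](eq_bigl P); last by move=> i; case: (boolP (P i)) => [/PQ ->|]; rewrite ?andbF.
suff : \rsum_(i | P' i) F i <= \rsum_(i | Q i && ~~ P i) F i by lra.
by apply: rsum_subset => // i Pi; rewrite PQ' //=; apply/negP => /dis.
Qed.

Lemma rsum_const (I : finType) (P : pred I) (c : R) :
  \rsum_(i | P i) c = INR #|[set i | P i]| * c.
Proof.
rewrite big_const cardsE; elim: #|_| => [|n IH]; first by rewrite /= Rmult_0_l.
by rewrite iterS IH S_INR; ring.
Qed.

Lemma cos_sin_inj a b : 0 <= a < 2 * PI -> 0 <= b < 2 * PI -> cos a = cos b -> sin a = sin b -> a = b.
Proof.
move=> ha hb hc hs.
have key : sin ((a - b) / 2) = 0.
  have : cos (2 * ((a - b) / 2)) = 1.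
    have -> : 2 * ((a - b) / 2) = a - b by field.
    by rewrite cos_minus hc hs; have := sin2_cos2 b; rewrite /Rsqr; lra.
  rewrite cos_2a_sin => h; nra.
case: (Rtotal_order a b) => [h|[//|h]]; exfalso.
  have : 0 < sin ((b - a) / 2) by apply: sin_gt_0; lra.
  have -> : (b - a) / 2 = - ((a - b) / 2) by field.
  by rewrite sin_neg key; lra.
have : 0 < sin ((a - b) / 2) by apply: sin_gt_0; lra.
by rewrite key; lra.
Qed.

(** The argument of the complex number [x + i y] in [0, 2 pi), written with [acos] so as to agree
    with [angle_at] when [y >= 0]. *)
Definition arg (x y : R) : R :=
  let t := acos (x / sqrt (x * x + y * y)) in if Rle_dec 0 y then t else 2 * PI - t.

Lemma argP x y : 0 < x * x + y * y ->
  [/\ 0 < sqrt (x * x + y * y), 0 <= arg x y < 2 * PI,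
   x = sqrt (x * x + y * y) * cos (arg x y) & y = sqrt (x * x + y * y) * sin (arg x y)].
Proof.
move=> n0; set r := sqrt _; have r0 : 0 < r by apply: sqrt_lt_R0.
have rr : r * r = x * x + y * y by rewrite /r sqrt_sqrt; lra.
have pi0 := PI_RGT_0.
pose q := x / r; have xq : x = r * q by rewrite /q; field; lra.
have q1 : -1 <= q <= 1.
  have h : x * x <= r * r by rewrite rr; nra.
  by split; apply: (Rmult_le_reg_l r) => //; rewrite -xq; nra.
have [t0 t1] := acos_bound q.
have ct : cos (acos q) = q by apply: cos_acos.
have st : sin (acos q) = sqrt (1 - Rsqr q) by apply: sin_acos.
have st2 : r * sin (acos q) = Rabs y.
  rewrite st -[r]sqrt_square; last lra.
  rewrite -sqrt_mult_alt; last nra.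
  rewrite -sqrt_Rsqr_abs; congr sqrt; rewrite /Rsqr; have : (r * q) * (r * q) = x * x by rewrite -xq.
  nra.
rewrite /arg -/r -/q; case: Rle_dec => hy /=; split=> //.
- lra.
- by rewrite ct.
- by rewrite st2 Rabs_pos_eq.
- split; first lra.
  suff : acos q <> 0 by lra.
  by move=> e; move: st2; rewrite e sin_0 Rmult_0_r Rabs_left; lra.
- by rewrite cos_minus cos_2PI sin_2PI ct xq; ring.
by rewrite sin_minus cos_2PI sin_2PI; rewrite Rabs_left in st2; lra.
Qed.

Lemma arg_unique x y r t : 0 < r -> 0 <= t < 2 * PI -> x = r * cos t -> y = r * sin t -> arg x y = t.
Proof.
move=> r0 ht ex ey.
have cs := sin2_cos2 t; rewrite /Rsqr in cs.
have rr : x * x + y * y = r * r.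
  have -> : x * x + y * y = r * r * (sin t * sin t + cos t * cos t) by rewrite ex ey; ring.
  by rewrite cs; ring.
have n0 : 0 < x * x + y * y by rewrite rr; nra.
have [_ ha hx hy] := argP n0.
rewrite rr sqrt_square in hx hy; last lra.
apply: cos_sin_inj => //; apply: (Rmult_eq_reg_l r); lra.
Qed.

Lemma arg_acos x y : 0 <= y -> arg x y = acos (x / sqrt (x * x + y * y)).
Proof. by rewrite /arg; case: Rle_dec. Qed.

Lemma arg_pos x y : 0 < y -> 0 < arg x y < PI.
Proof.
move=> y0; have n0 : 0 < x * x + y * y by nra.
have [r0 [h1 h2] _ ey] := argP n0; have pi0 := PI_RGT_0.
have s0 : 0 < sin (arg x y).
  by apply: (Rmult_lt_reg_l (sqrt (x * x + y * y))) => //; rewrite -ey; lra.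
split.
  by case: (Rle_lt_or_eq_dec _ _ h1) => // e; move: s0; rewrite -e sin_0; lra.
case: (Rlt_le_dec (arg x y) PI) => // h; have := sin_le_0 _ h; lra.
Qed.

Lemma pos_arg x y : 0 < x * x + y * y -> 0 < arg x y < PI -> 0 < y.
Proof.
move=> n0 [h1 h2]; have [r0 _ _ ->] := argP n0.
by apply: Rmult_lt_0_compat => //; apply: sin_gt_0.
Qed.

Lemma neg_arg x y : 0 < x * x + y * y -> PI < arg x y -> y < 0.
Proof.
move=> n0 h1; have [r0 [_ h2] _ e] := argP n0.
have := sin_lt_0 _ h1 h2; set s := sin _ in e *; nra.
Qed.

Lemma arg_opp x y : y <> 0 -> arg x (- y) = 2 * PI - arg x y.
Proof.
move=> y0; have n0 : 0 < x * x + y * y by nra.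
have [r0 [h1 h2] ex ey] := argP n0.
have h3 : arg x y <> 0 by move=> e; apply: y0; rewrite ey e sin_0; ring.
apply: (arg_unique r0); first lra.
  by rewrite cos_minus cos_2PI sin_2PI {1}ex; ring.
by rewrite sin_minus cos_2PI sin_2PI {1}ey; ring.
Qed.

(* [arg] turns complex multiplication into addition modulo [2 * PI]. *)
Lemma arg_mul x y x' y' k u v : 0 < x * x + y * y -> 0 < x' * x' + y' * y' -> 0 < k ->
  x * x' - y * y' = k * u -> x * y' + y * x' = k * v ->
  arg u v = arg x y + arg x' y' \/ arg u v = arg x y + arg x' y' - 2 * PI.
Proof.
move=> n0 n0' k0 eu ev.
have [r0 h1 ex ey] := argP n0; have [r0' h1' ex' ey'] := argP n0'.
set r := sqrt _ in r0 ex ey; set r' := sqrt _ in r0' ex' ey'.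
set t := arg x y in h1 ex ey *; set t' := arg x' y' in h1' ex' ey' *.
have rk : 0 < r * r' / k by apply: Rdiv_lt_0_compat => //; apply: Rmult_lt_0_compat.
have eu' : u = r * r' / k * cos (t + t').
  apply: (Rmult_eq_reg_l k); last lra.
  rewrite -eu cos_plus ex ex' ey ey'; field; lra.
have ev' : v = r * r' / k * sin (t + t').
  apply: (Rmult_eq_reg_l k); last lra.
  rewrite -ev sin_plus ex ex' ey ey'; field; lra.
case: (Rlt_le_dec (t + t') (2 * PI)) => h; [left | right].
  by apply: (arg_unique rk) => //; lra.
apply: (arg_unique rk); first lra.
  by rewrite cos_minus cos_2PI sin_2PI eu'; ring.
by rewrite sin_minus cos_2PI sin_2PI ev'; ring.
Qed.

(** The product of the three complex numbers is the negative real [- k], so their arguments sum to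
    an odd multiple of pi; the sum lies strictly between 0 and 3 pi. *)
Lemma arg_triangle x y x' y' x'' y'' k : 0 < y -> 0 < y' -> 0 < y'' -> 0 < k ->
  (x * x' - y * y') * x'' - (x * y' + y * x') * y'' = - k ->
  (x * x' - y * y') * y'' + (x * y' + y * x') * x'' = 0 ->
  arg x y + arg x' y' + arg x'' y'' = PI.
Proof.
move=> y0 y0' y0'' k0 e1 e2.
have n0 : 0 < x * x + y * y by nra.
have n0' : 0 < x' * x' + y' * y' by nra.
have n0'' : 0 < x'' * x'' + y'' * y'' by nra.
have [r0 _ ex ey] := argP n0; have [r0' _ ex' ey'] := argP n0'; have [r0'' _ ex'' ey''] := argP n0''.
have b := arg_pos x y0; have b' := arg_pos x' y0'; have b'' := arg_pos x'' y0''.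
set t := arg x y in ex ey b *; set t' := arg x' y' in ex' ey' b' *; set t'' := arg x'' y'' in ex'' ey'' b'' *.
set r := sqrt _ in r0 ex ey; set r' := sqrt _ in r0' ex' ey'; set r'' := sqrt _ in r0'' ex'' ey''.
have R0 : 0 < r * r' * r'' by apply: Rmult_lt_0_compat => //; apply: Rmult_lt_0_compat.
have hc : r * r' * r'' * cos (t + t' + t'') = - k.
  by rewrite -e1 cos_plus cos_plus sin_plus ex ex' ex'' ey ey' ey''; ring.
have hs : r * r' * r'' * sin (t + t' + t'') = 0.
  by rewrite -e2 sin_plus cos_plus sin_plus ex ex' ex'' ey ey' ey''; ring.
have hc' : cos (t + t' + t'') < 0 by nra.
have hs' : sin (t + t' + t'') = 0 by nra.
set S := t + t' + t'' in hc' hs' *.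
have S0 : 0 < S < 3 * PI by rewrite /S; lra.
have pi0 := PI_RGT_0.
case: (Rtotal_order S PI) => [h|[//|h]]; exfalso.
  have : 0 < sin S by apply: sin_gt_0; lra.
  lra.
case: (Rlt_le_dec S (2 * PI)) => h2.
  by have := sin_lt_0 _ h h2; lra.
case: (Rle_lt_or_eq_dec _ _ h2) => h3; last by move: hc'; rewrite -h3 cos_2PI; lra.
have : 0 < sin (S - 2 * PI) by apply: sin_gt_0; lra.
rewrite sin_minus cos_2PI sin_2PI hs'; lra.
Qed.

(** * Angles around a vertex *)

Section Angles.

Variables (V : finType) (X Y : V -> R) (T : {set V * V}).
Hypothesis planeT : plane_set X Y T.
Hypothesis XY_inj : forall p q, X p = X q -> Y p = Y q -> p = q.
Local Notation cr := (cr X Y).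
Local Notation face := (face X Y T).
Local Notation third := (third X Y T).
Local Notation tri := (tri X Y T).
Local Notation rot := (rot X Y T).

Definition dt v a b := (X a - X v) * (X b - X v) + (Y a - Y v) * (Y b - Y v).

(** The counterclockwise angle from [va] to [vb]: [dt] and [cr] are the real and imaginary parts of
    the conjugate of [a - v] times [b - v]. *)
Definition Ang v a b := arg (dt v a b) (cr v a b).

Lemma dt_pos v a : v <> a -> 0 < dt v a a.
Proof.
move=> va; rewrite /dt.
case: (Req_dec (X a) (X v)) => e1; last first.
  have h1 : X a - X v <> 0 by lra.
  by have := Rlt_0_sqr _ h1; have := Rle_0_sqr (Y a - Y v); rewrite /Rsqr; lra.
case: (Req_dec (Y a) (Y v)) => e2; first by exfalso; apply: va; apply: XY_inj.
have h2 : Y a - Y v <> 0 by lra.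
by have := Rlt_0_sqr _ h2; have := Rle_0_sqr (X a - X v); rewrite /Rsqr; lra.
Qed.

Lemma lagrange v a b : dt v a b * dt v a b + cr v a b * cr v a b = dt v a a * dt v b b.
Proof. rewrite /dt /cr /det3; ring. Qed.

Lemma lagrange_pos v a b : v <> a -> v <> b -> 0 < dt v a b * dt v a b + cr v a b * cr v a b.
Proof. by move=> va vb; rewrite lagrange; apply: Rmult_lt_0_compat; apply: dt_pos. Qed.

Lemma Ang_bound v a b : v <> a -> v <> b -> 0 <= Ang v a b < 2 * PI.
Proof. by move=> va vb; case: (argP (lagrange_pos va vb)). Qed.

Lemma AngD v a b c : v <> a -> v <> b -> v <> c ->
  Ang v a c = Ang v a b + Ang v b c \/ Ang v a c = Ang v a b + Ang v b c - 2 * PI.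
Proof.
move=> va vb vc; apply: (arg_mul (k := dt v b b)); rewrite ?lagrange_pos //.
- exact: lagrange_pos.
- exact: lagrange_pos.
- exact: dt_pos.
- by rewrite /dt /cr /det3; ring.
- by rewrite /dt /cr /det3; ring.
Qed.

Lemma Ang_self v a : v <> a -> Ang v a a = 0.
Proof.
move=> va; have d0 := dt_pos va; have pi0 := PI_RGT_0.
apply: (arg_unique d0); [lra | by rewrite cos_0; ring | by rewrite sin_0 crxyy; ring].
Qed.

Lemma Ang_face a b c : 0 < cr a b c -> 0 < Ang a b c < PI.
Proof. exact: arg_pos. Qed.

Lemma Ang_cr a b c : a <> b -> a <> c -> 0 < Ang a b c < PI -> 0 < cr a b c.
Proof. by move=> ab ac; apply: pos_arg; apply: lagrange_pos. Qed.

Lemma Ang_triangle a b c : 0 < cr a b c -> Ang a b c + Ang b c a + Ang c a b = PI.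
Proof.
move=> h; have hb : 0 < cr b c a by rewrite cr_rot.
have hc : 0 < cr c a b by rewrite cr_rot.
have ab : a <> b by move=> e; rewrite e crxx in h; lra.
have bc : b <> c by move=> e; rewrite e crxyy in h; lra.
have ca : c <> a by move=> e; rewrite e crxyx in h; lra.
(* Each side occurs in the product once as a vector and once as the conjugate of its opposite,
   giving minus its squared length. *)
apply: (arg_triangle (k := dt a b b * dt b c c * dt c a a)) => //.
- by do 2!(apply: Rmult_lt_0_compat; last exact: dt_pos); exact: dt_pos.
- by rewrite /dt /cr /det3; ring.
- by rewrite /dt /cr /det3; ring.
Qed.

Lemma Ang_opp a b c : cr a b c <> 0 -> Ang a c b = 2 * PI - Ang a b c.
Proof.
move=> h; rewrite -(arg_opp _ h) /Ang cr_opp2; congr arg; rewrite /dt; ring.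
Qed.

Lemma Ang_eq r v z z' : v <> r -> (v, z) \in T -> (v, z') \in T -> Ang v r z = Ang v r z' -> z = z'.
Proof.
move=> vr h1 h2 e.
have vz := T_irr planeT h1; have vz' := T_irr planeT h2.
have b := Ang_bound vz vz'.
have e0 : Ang v z z' = 0 by case: (AngD vr vz vz'); lra.
have [n0 _ ex ey] := argP (lagrange_pos vz vz').
rewrite -/(Ang v z z') e0 cos_0 sin_0 in ex ey.
apply: (ray_unique planeT XY_inj h1 h2); first by rewrite ey; ring.
case=> s [hs fx fy].
have d0 : 0 < dt v z z' by rewrite ex; lra.
have d1 := dt_pos vz'.
have : (1 - s) * dt v z z' + s * dt v z' z' = 0 by rewrite /dt fx fy; ring.
have : 0 < (1 - s) * dt v z z' by apply: Rmult_lt_0_compat; lra.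
have : 0 < s * dt v z' z' by apply: Rmult_lt_0_compat; lra.
lra.
Qed.

Definition corner d := if third d is Some c then Ang d.1 d.2 c else 0.

Lemma corner_face a b c : face a b c -> corner (a, b) = Ang a b c.
Proof. by move=> /(thirdP planeT XY_inj) h; rewrite /corner h. Qed.

Lemma corner_pos d : tri d -> 0 < corner d.
Proof.
case: d => a b /(triP planeT XY_inj)[c h]; rewrite (corner_face h).
by have [_ _ _ D0 _] := h; case: (Ang_face D0).
Qed.

Lemma corner_ge0 d : 0 <= corner d.
Proof.
case: (boolP (tri d)) => [/corner_pos|]; first lra.
by rewrite /tri /corner; case: (third d) => // _; lra.
Qed.

Lemma corner_sum d : tri d -> corner d + corner (rot d) + corner (rot (rot d)) = PI.
Proof.
case: d => a b /(triP planeT XY_inj)[c h]; have h' := face_rot h; have h'' := face_rot h'.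
rewrite !(rot_face planeT XY_inj h) (rot_face planeT XY_inj h') (corner_face h) (corner_face h') (corner_face h'').
by have [_ _ _ D0 _] := h; apply: Ang_triangle.
Qed.

Lemma corner_total (Q : pred (V * V)) : (forall d, tri d -> Q (rot d) = Q d) ->
  3 * (\rsum_(d | tri d && Q d) corner d) = INR #|[set d | tri d & Q d]| * PI.
Proof.
move=> Qrot; rewrite -rsum_const.
have Qr d : tri d && Q d = tri (rot d) && Q (rot d).
  by rewrite tri_rot //; case: (boolP (tri d)) => //= td; rewrite Qrot.
have e1 : \rsum_(d | tri d && Q d) corner (rot d) = \rsum_(d | tri d && Q d) corner d.
  rewrite [RHS](reindex_inj (rot_inj planeT XY_inj)); apply: eq_bigl => d; exact: Qr.
have e2 : \rsum_(d | tri d && Q d) corner (rot (rot d)) = \rsum_(d | tri d && Q d) corner d.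
  rewrite -[RHS]e1 [RHS](reindex_inj (rot_inj planeT XY_inj)); apply: eq_bigl => d; exact: Qr.
transitivity (\rsum_(d | tri d && Q d) (corner d + corner (rot d) + corner (rot (rot d)))).
  rewrite !big_split /= e1 e2; set S := \rsum_(d | tri d && Q d) corner d.
  by transitivity (S + S + S); first ring.
by apply: eq_bigr => d /andP[td _]; exact: corner_sum.
Qed.

Lemma between_cone v r z n x : v <> r -> face v z n -> (v, x) \in T ->
  Ang v r z < Ang v r x -> Ang v r x < Ang v r z + Ang v z n -> False.
Proof.
move=> vr h vxT h1 h2; have [vzT _ nvT D0 _] := h.
have vz := T_irr planeT vzT; have vx := T_irr planeT vxT; have vn := nesym (T_irr planeT nvT).
have b1 := Ang_bound vr vz; have b2 := Ang_bound vr vx; have b3 := Ang_bound vz vx.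
have b4 := Ang_bound vx vn; have b5 := Ang_face D0.
have e1 : Ang v z x = Ang v r x - Ang v r z by case: (AngD vr vz vx); lra.
have e2 : Ang v x n = Ang v z n - Ang v z x by case: (AngD vz vx vn); lra.
by apply: (face_cone planeT h vxT); apply: Ang_cr => //; lra.
Qed.

(** Turning from [z] to [n] cannot step over [r], itself a neighbour of [v]; the angle measured from
    [r] wraps around only when [n] is on the ray of [r]. *)
Lemma Ang_next v r z n : (v, r) \in T -> face v z n ->
  Ang v r n = Ang v r z + Ang v z n \/ (Ang v r n = 0 /\ Ang v r z + Ang v z n = 2 * PI).
Proof.
move=> vrT h; have [vzT _ nvT D0 _] := h.
have vr := T_irr planeT vrT; have vz := T_irr planeT vzT; have vn := nesym (T_irr planeT nvT).
have b1 := Ang_bound vr vz; have b3 := Ang_bound vr vn; have b5 := Ang_face D0.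
case: (AngD vr vz vn) => e; [by left|].
case: (Req_dec (Ang v r n) 0) => e0; [by right; lra|exfalso].
apply: (face_cone planeT h vrT); last by apply: Ang_cr => //; lra.
have : cr v r z < 0 by apply: (neg_arg (lagrange_pos vr vz)); rewrite -/(Ang v r z); lra.
rewrite cr_opp2; lra.
Qed.

(** * Walking around a bend inside one class *)

Section Walk.

Variables (W : finType) (cls : V * V -> W) (f0 : W) (orig : pred (V * V)).
Hypothesis cls_rot : forall d, tri d -> cls (rot d) = cls d.
Hypothesis cls_swap : forall a b, (a, b) \in T -> ~~ orig (a, b) -> cls (b, a) = cls (a, b).
Hypothesis cls_hull : forall d, d \in T -> ~~ tri d -> cls d = f0.

Variables (v r x : V).
Hypotheses (vrT : (v, r) \in T) (vxT : (v, x) \in T).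
Hypothesis orig_out : forall z, (v, z) \in T -> orig (v, z) -> z = r \/ z = x.
Hypothesis orig_in : forall z, (v, z) \in T -> orig (z, v) -> z = r \/ z = x.

Let vr := T_irr planeT vrT.
Let vx := T_irr planeT vxT.
Local Notation A := (Ang v r).

Lemma Ar0 : A r = 0. Proof. exact: Ang_self. Qed.

(* Turning around [v] from [r] to [x], two consecutive triangles share a segment which is not original, hence lie in the same class. *)
Lemma walk_ccw z f : f <> f0 -> (v, z) \in T -> A z < A x -> cls (v, z) = f ->
  cls (x, v) = f /\
  A x - A z <= \rsum_(t | [&& tri (v, t), cls (v, t) == f & `[< A z <= A t < A x >]]) corner (v, t).
Proof.
move=> ff0.
pose later z := #|[set t | (v, t) \in T & `[< A z < A t >]]|.
have [k] := ubnP (later z); elim: k z => // k IH z hk vzT zx cz.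
have tz : tri (v, z).
  by case: (boolP (tri (v, z))) => // nt; case: ff0; rewrite -cz; apply: cls_hull.
have [n h] : exists n, face v z n by move: tz => /(triP planeT XY_inj).
have [_ _ nvT D0 _] := h; have vnT := T_sym planeT nvT.
have vz := T_irr planeT vzT; have vn := T_irr planeT vnT.
have b1 := Ang_bound vr vz; have b2 := Ang_bound vr vx; have b3 := Ang_face D0.
(* [x] is a neighbour of [v], so the next segment cannot overshoot it. *)
have le : A z + Ang v z n <= A x.
  by case: (Rle_lt_dec (A z + Ang v z n) (A x)) => // lt; case: (between_cone vr h vxT zx lt).
have An : A n = A z + Ang v z n by case: (Ang_next vrT h); lra.
have cn : cls (n, v) = f.
  rewrite -cz -(cls_rot tz) (rot_face planeT XY_inj h).
  have tzn : tri (z, n) by rewrite -(rot_face planeT XY_inj h) tri_rot.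
  by rewrite -(cls_rot tzn) (rot_face planeT XY_inj (face_rot h)).
have cor : corner (v, z) = A n - A z by rewrite (corner_face h); lra.
case: (Req_dec (A n) (A x)) => nx.
  have <- := Ang_eq vr vnT vxT nx; split=> //.
  rewrite (bigD1 z) /=; last first.
    by rewrite tz cz eqxx /=; apply/asboolP; lra.
  set S := \big[_/_]_(_ | _) _.
  have : 0 <= S by apply: rsum_ge0 => t _; exact: corner_ge0.
  lra.
have no : ~~ orig (n, v).
  apply/negP => /(orig_in vnT) [e|e]; last by apply: nx; rewrite e.
  have : A n = 0 by rewrite e Ar0.
  lra.
have cn' : cls (v, n) = f by rewrite cls_swap.
have [] := IH n; rewrite ?vnT //; last 2 first.
- lra.
- move=> cx sum; split=> //.
  rewrite (bigD1 z) /=; last by rewrite tz cz eqxx /=; apply/asboolP; lra.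
  apply: (Rle_trans _ (corner (v, z) + (A x - A n))); first by lra.
  apply: Rplus_le_compat_l; apply: (Rle_trans _ _ _ sum).
  apply: (@rsum_subset _ _ _ (fun t => corner (v, t))) => [t|t /and3P[-> -> /asboolP ht]] /=.
    exact: corner_ge0.
  apply/andP; split; first by apply/asboolP; lra.
  by apply/eqP => e; move: ht; rewrite e; lra.
move: hk; rewrite ltnS; apply: leq_trans.
apply: proper_card; apply/properP; split.
  by apply/subsetP => t; rewrite !inE => /andP[-> /asboolP ht] /=; apply/asboolP; lra.
exists n; rewrite !inE vnT /=; first by apply/asboolP; lra.
by apply/asboolP; lra.
Qed.

(** The same turn, made clockwise. Each walk needs a class other than [f0], so as not to run into
    the outer region, and starts where the class is known. *)
Lemma walk_cw z f : f <> f0 -> (v, z) \in T -> 0 < A z <= A x -> cls (z, v) = f -> cls (v, r) = f.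
Proof.
move=> ff0.
pose later z := #|[set t | (v, t) \in T & `[< A t < A z >]]|.
have [k] := ubnP (later z); elim: k z => // k IH z hk vzT zx cz.
have zvT := T_sym planeT vzT.
have tz : tri (z, v).
  by case: (boolP (tri (z, v))) => // nt; case: ff0; rewrite -cz; apply: cls_hull.
have [p h'] : exists n, face z v n by move: tz => /(triP planeT XY_inj).
have h := face_rot h'.
have [vpT _ _ D0 _] := h.
have vz := T_irr planeT vzT; have vp := T_irr planeT vpT.
have b1 := Ang_bound vr vz; have b2 := Ang_bound vr vp; have b3 := Ang_face D0.
have Ap : A p = A z - Ang v p z by case: (Ang_next vrT h); lra.
have cp : cls (v, p) = f by rewrite -cz -(cls_rot tz) (rot_face planeT XY_inj h').
case: (Req_dec (A p) 0) => p0.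
  by have <- : p = r by [apply: (Ang_eq vr vpT vrT); rewrite Ar0].
have no : ~~ orig (v, p).
  apply/negP => /(orig_out vpT) [e|e]; first by apply: p0; rewrite e Ar0.
  have : A p = A x by rewrite e.
  lra.
apply: (IH p) => //; last 2 first.
- lra.
- by rewrite cls_swap.
move: hk; rewrite ltnS; apply: leq_trans.
apply: proper_card; apply/properP; split.
  by apply/subsetP => t; rewrite !inE => /andP[-> /asboolP ht] /=; apply/asboolP; lra.
exists p; rewrite !inE vpT /=; first by apply/asboolP; lra.
by apply/asboolP; lra.
Qed.

Hypothesis rx : 0 < A x.

(** If one of the two darts has a class other than [f0], the walk starting from it reaches the
    other; otherwise both are in [f0]. *)
Lemma cls_wedge : cls (v, r) = cls (x, v).
Proof.
case: (eqVneq (cls (v, r)) f0) => [e|/eqP ne].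
  case: (eqVneq (cls (x, v)) f0) => [->//|/eqP ne].
  by apply: (walk_cw ne vxT) => //; lra.
by case: (walk_ccw ne vrT); rewrite ?Ar0.
Qed.

Lemma wedge_angle f : f <> f0 -> cls (v, r) = f ->
  A x <= \rsum_(t | [&& tri (v, t), cls (v, t) == f & `[< A t < A x >]]) corner (v, t).
Proof.
move=> ff0 e; case: (walk_ccw ff0 vrT _ e); rewrite ?Ar0 // => _ h.
have h' : A x <= A x - 0 by lra.
apply: (Rle_trans _ _ _ h'); apply: (Rle_trans _ _ _ h).
apply: (@rsum_subset _ _ _ (fun t => corner (v, t))) => [t|t /and3P[-> -> /asboolP ht]] /=.
  exact: corner_ge0.
by apply/asboolP; lra.
Qed.

End Walk.
End Angles.

(** * Counting by classes *)

Lemma sum_fibers (I W : finType) (c : I -> W) (P : pred I) :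
  (\sum_f #|[set i | P i && (c i == f)]| = #|[set i | P i]|)%N.
Proof.
rewrite -[RHS]sum1_card (partition_big c xpredT) //=; apply: eq_bigr => f _.
by rewrite -sum1_card; apply: eq_bigl => i; rewrite !inE.
Qed.

Lemma card_indicator (I : finType) (A : {set I}) : (#|A| = \sum_i (i \in A))%N.
Proof. by rewrite -sum1_card big_mkcond; apply: eq_bigr => i _; case: (i \in A). Qed.

Lemma INR_addn (m n : nat) : INR (m + n)%N = INR m + INR n.
Proof. exact: plus_INR. Qed.

Lemma INR_muln (m n : nat) : INR (m * n)%N = INR m * INR n.
Proof. exact: mult_INR. Qed.

(** The first equation makes [t] even, [t = 2 u], and with the second gives [u >= C + r - 1]. If
    [C <= r], the bound on [alpha] gives [3 u >= 2 r + C + 1]. If [r < C], positivity of [alpha]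
    gives [u >= r + 1], so [4 u >= 4 r + 2 C]. *)
Lemma inner_arith (alpha : R) (t m C r : nat) : 0 < alpha <= 2 * PI / 3 ->
  (3 * t = 2 * m + 2 * (C + r))%N -> (t <= m + 1)%N ->
  ((0 < C + r)%N -> INR C * alpha + INR r * (2 * PI - alpha) < INR t * PI) ->
  (3 * r + 2 * C <= 2 * t)%N.
Proof.
move=> [a0 a1] e1 e2 hr; have pi0 := PI_RGT_0.
case: (posnP (C + r)) => [?|cr0]; first by lia.
have {hr} := hr cr0.
case: (leqP C r) => Cr hr.
  have h : 2 * INR (2 * r + C) < 3 * INR t.
    have : INR C <= INR r by apply: le_INR; lia.
    have -> : INR (2 * r + C)%N = 2 * INR r + INR C by rewrite INR_addn INR_muln /=; lra.
    move: (INR C) (INR r) (INR t) hr => c1 r1 t1 hr hc; apply: (Rmult_lt_reg_r PI) => //.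
    have : (r1 - c1) * alpha <= (r1 - c1) * (2 * PI / 3) by apply: Rmult_le_compat_l; lra.
    lra.
  have {}h : (2 * (2 * r + C) < 3 * t)%N.
    by apply/ltP; apply: INR_lt; rewrite !INR_muln /=; move: h; rewrite INR_addn INR_muln /=; lra.
  lia.
have h : 2 * INR r < INR t.
  have : INR r < INR C by apply: lt_INR; lia.
  move: (INR C) (INR r) (INR t) hr => c1 r1 t1 hr hc; apply: (Rmult_lt_reg_r PI) => //.
  have : 0 < (c1 - r1) * alpha by apply: Rmult_lt_0_compat; lra.
  lra.
have {}h : (2 * r < t)%N by apply/ltP; apply: INR_lt; rewrite INR_muln /=; lra.
lia.
Qed.

Section Counting.

Variables (V : finType) (X Y : V -> R) (T : {set V * V}).
Hypothesis planeT : plane_set X Y T.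
Hypothesis maxT : forall T', plane_set X Y T' -> T \subset T' -> T' = T.
Hypothesis XY_inj : forall p q, X p = X q -> Y p = Y q -> p = q.
Variable eps : R.
Hypothesis g_inj : injective (lin X Y eps).
Local Notation cr := (cr X Y).
Local Notation face := (face X Y T).
Local Notation tri := (tri X Y T).
Local Notation rot := (rot X Y T).
Local Notation special := (special X Y T eps).
Local Notation glt := (glt X Y eps).
Local Notation corner := (corner X Y T).

Variables (J : finType) (bend pa pc : J -> V) (alpha : R).
Hypothesis alpha_bound : 0 < alpha <= 2 * PI / 3.
Hypothesis bend_inj : injective bend.
Hypothesis pa_bend : forall i j, pa i <> bend j.
Hypothesis pc_bend : forall i j, pc i <> bend j.
Hypothesis paT : forall j, (bend j, pa j) \in T.
Hypothesis pcT : forall j, (bend j, pc j) \in T.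
Hypothesis ccw : forall j, 0 < cr (pa j) (bend j) (pc j).
Hypothesis bend_angle : forall j, Ang X Y (bend j) (pc j) (pa j) = alpha.

Lemma pa_pc j : pa j <> pc j.
Proof. by move=> e; have := ccw j; rewrite e crxyx; lra. Qed.

Definition half (k : J * (bool * bool)) : V * V :=
  let p := if k.2.1 then pa k.1 else pc k.1 in
  if k.2.2 then (p, bend k.1) else (bend k.1, p).

Lemma half_inj : injective half.
Proof.
move=> [i [s o]] [j [s' o']]; rewrite /half /=.
case: o; case: o' => -[h1 h2].
- move/bend_inj: h2 => ?; subst j; move: h1; case: s; case: s' => // h1.
    by case: (@pa_pc i).
  by case: (@pa_pc i).
- by exfalso; move: h1; case: s; [apply: pa_bend | apply: pc_bend].
- by exfalso; move/esym: h1; case: s'; [apply: pa_bend | apply: pc_bend].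
move/bend_inj: h1 => ?; subst j; move: h2; case: s; case: s' => // h2.
  by case: (@pa_pc i).
by case: (@pa_pc i).
Qed.

Lemma half_T k : half k \in T.
Proof.
rewrite /half; case: k => j [[] []] /=.
- exact: (T_sym planeT (paT j)).
- exact: paT.
- exact: (T_sym planeT (pcT j)).
- exact: pcT.
Qed.

Definition orig d := d \in codom half.

Lemma orig_sym a b : orig (a, b) -> orig (b, a).
Proof.
case/codomP => -[j [s o]] e; apply/codomP; exists (j, (s, ~~ o)); move: e.
by rewrite /half /=; case: o => /= -[-> ->].
Qed.

Lemma orig_bend j z : orig (bend j, z) -> z = pa j \/ z = pc j.
Proof.
case/codomP => -[i [s o]]; rewrite /half /=; case: o => /= -[].
  by case: s => e; exfalso; [apply: (@pa_bend i j) | apply: (@pc_bend i j)].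
by move=> /bend_inj <-; case: s => ->; [left|right].
Qed.

(* A triangle is represented by its special dart, the outer region by [None]. *)
Definition node d : option (V * V) :=
  if tri d then Some (if special d then d else if special (rot d) then rot d else rot (rot d))
  else None.

Lemma node_rot d : tri d -> node (rot d) = node d.
Proof.
move=> td; rewrite /node tri_rot // td rot3 //.
have := special_one planeT XY_inj g_inj td.
by case: (special d); case: (special (rot d)); case: (special (rot (rot d))).
Qed.

Lemma node_special d : tri d -> special d -> node d = Some d.
Proof. by move=> td sd; rewrite /node td sd. Qed.

(** The added segments, each taken once, in the direction of the sweep. *)
Definition diagonals := [set d in T | ~~ orig d & glt d.1 d.2].

Lemma in_diagonals d : (d \in diagonals) = [&& d \in T, ~~ orig d & glt d.1 d.2].
Proof. by rewrite /diagonals inE. Qed.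

(** [merge_classes] on the dual graph: nodes are triangles and the outer region, joined across added
    segments. *)
Lemma class_function : exists G : option (V * V) -> option (V * V),
  (forall a b, (a, b) \in T -> ~~ orig (a, b) -> G (node (b, a)) = G (node (a, b))) /\
  forall f, (#|[set w | G w == f]| <= #|[set d in diagonals | G (node d) == f]| + 1)%N.
Proof.
have [G [h1 h2]] := merge_classes [seq (node d, node (d.2, d.1)) | d <- enum diagonals].
exists G; split=> [a b abT no|f].
  have key x y : (x, y) \in diagonals -> G (node (x, y)) = G (node (y, x)).
    move=> h; apply: (h1 (node (x, y), node (y, x))).
    by apply/mapP; exists (x, y) => //; rewrite mem_enum.
  have ab := T_irr planeT abT.
  case: (boolP (glt a b)) => gab; first by rewrite (key a b) // in_diagonals abT no.
  rewrite (key b a) // in_diagonals (T_sym planeT abT) /= (glt_total g_inj (nesym ab)) gab andbT.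
  by apply: contra no; apply: orig_sym.
apply: leq_trans (h2 f) _; rewrite leq_add2r count_map.
rewrite -size_filter cardE; apply/eq_leq/perm_size/uniq_perm.
- by rewrite filter_uniq // enum_uniq.
- exact: enum_uniq.
by move=> d; rewrite mem_filter !mem_enum /= [RHS]inE andbC.
Qed.

(** * Inequalities for a single class *)

Section Classes.

Variable G : option (V * V) -> option (V * V).
Hypothesis G_swap : forall a b, (a, b) \in T -> ~~ orig (a, b) -> G (node (b, a)) = G (node (a, b)).
Hypothesis G_size : forall f, (#|[set w | G w == f]| <= #|[set d in diagonals | G (node d) == f]| + 1)%N.

Definition cls d := G (node d).
Let f0 := G None.

Lemma cls_rot d : tri d -> cls (rot d) = cls d.
Proof. by move=> td; rewrite /cls node_rot. Qed.

Lemma cls_hull d : d \in T -> ~~ tri d -> cls d = f0.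
Proof. by move=> _ /negbTE h; rewrite /cls /node h. Qed.

Definition ntri f := #|[set d | tri d & (cls d == f) && special d]|.
Definition nhull := #|[set d in T | ~~ tri d]|.
Definition ndiag f := #|[set d in diagonals | cls d == f]|.
(** By [ccw], the darts [pa], [bend], [pc] in this order have the convex side of the edge on their
    left; the reversed darts have the reflex side. *)
Definition nconv f := #|[set j | cls (pa j, bend j) == f]|.
Definition nrefl f := #|[set j | cls (pc j, bend j) == f]|.

Lemma alpha_pi : 0 < alpha < PI.
Proof. have := PI_RGT_0; lra. Qed.

Lemma reflex_angle j : Ang X Y (bend j) (pa j) (pc j) = 2 * PI - alpha.
Proof.
rewrite -(bend_angle j); apply: Ang_opp.
by rewrite cr_rot; have := ccw j; lra.
Qed.

(** No original segment lies strictly between the two halves of the edge at its bend, so both darts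
    of one side get the same class. *)
Lemma cls_convex j : cls (bend j, pc j) = cls (pa j, bend j).
Proof.
apply: (cls_wedge planeT XY_inj cls_rot G_swap cls_hull (pcT j) (paT j)).
- by move=> z _ /orig_bend; tauto.
- by move=> z _ /orig_sym /orig_bend; tauto.
rewrite bend_angle; have := alpha_pi; lra.
Qed.

Lemma cls_reflex j : cls (bend j, pa j) = cls (pc j, bend j).
Proof.
apply: (cls_wedge planeT XY_inj cls_rot G_swap cls_hull (paT j) (pcT j)).
- by move=> z _ /orig_bend; tauto.
- by move=> z _ /orig_sym /orig_bend; tauto.
rewrite reflex_angle; have := alpha_pi; lra.
Qed.

Lemma norig f : (#|[set d in T | orig d & cls d == f]| = 2 * (nconv f + nrefl f))%N.
Proof.
have -> : [set d in T | orig d & cls d == f] = half @: [set k | cls (half k) == f].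
  apply/setP => d; rewrite !inE; apply/idP/imsetP.
    case/and3P => _ /codomP[k ->] h; exists k => //; by rewrite inE.
  by case=> k; rewrite inE => h ->; rewrite half_T h andbT /orig codom_f.
rewrite card_imset; last exact: half_inj.
pose F (j : J) (so : bool * bool) := nat_of_bool (cls (half (j, so)) == f).
transitivity (\sum_j \sum_so F j so)%N.
  rewrite pair_big /= card_indicator; apply: eq_bigr => -[j so] _.
  by rewrite inE.
transitivity (\sum_j (2 * ((cls (pa j, bend j) == f) + (cls (pc j, bend j) == f))))%N.
  apply: eq_bigr => j _; rewrite -(pair_big xpredT xpredT (fun s o => F j (s, o))) /=.
  rewrite !big_bool /F /half /= cls_convex cls_reflex; lia.
rewrite -big_distrr /= big_split /= /nconv /nrefl !card_indicator.
by congr (2 * (_ + _))%N; apply: eq_bigr => j _; rewrite inE.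
Qed.

Lemma card_swap_diag f : (#|[set d in T | ~~ orig d & cls d == f]| = 2 * ndiag f)%N.
Proof.
pose sw (d : V * V) := (d.2, d.1).
have sw_inj : injective sw by move=> [a b] [c d] [-> ->].
rewrite (_ : [set d in T | ~~ orig d & cls d == f] =
   [set d in diagonals | cls d == f] :|: sw @: [set d in diagonals | cls d == f]); last first.
  apply/setP => -[a b]; rewrite !inE /=; apply/idP/idP.
    case/and3P => abT no /eqP cab; have ab := T_irr planeT abT.
    case: (boolP (glt a b)) => gab; first by rewrite abT no cab eqxx.
    apply/orP; right; apply/imsetP; exists (b, a) => //.
    rewrite !inE /= (T_sym planeT abT) /= (glt_total g_inj (nesym ab)) gab /= andbT.
    rewrite andbC /cls (G_swap abT no) -/(cls (a, b)) cab eqxx /= ?andbT.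
    by apply: contra no; apply: orig_sym.
  case/orP => [/andP[/and3P[-> -> _] ->] //|/imsetP[[c d]]].
  rewrite !inE /= => /andP[/and3P[cdT no gcd] ccd] [-> ->].
  rewrite (T_sym planeT cdT) /= /cls (G_swap cdT no) -/(cls (c, d)) ccd andbT.
  by apply: contra no; apply: orig_sym.
rewrite cardsU disjoint_setI0 ?cards0 ?subn0; last first.
  rewrite disjoint_subset; apply/subsetP => -[a b]; rewrite !inE /= => /andP[/and3P[abT no gab] _].
  apply/negP => /imsetP[[c d]]; rewrite !inE /= => /andP[/and3P[cdT _ gcd] _] [e1 e2]; subst c d.
  by move: gab; rewrite (glt_total g_inj (T_irr planeT abT)) gcd.
by rewrite card_imset // addnn -mul2n.
Qed.

(** Double count of the darts whose left side is in class [f]: three per triangle and the hull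
    darts, against two per added segment and two per side of an edge. *)
Lemma ndarts f : (3 * ntri f + (f == f0) * nhull = 2 * ndiag f + 2 * (nconv f + nrefl f))%N.
Proof.
rewrite -norig -card_swap_diag -(special_third planeT XY_inj g_inj (Q := fun d => cls d == f)); last first.
  by move=> d td; rewrite cls_rot.
have -> : ((f == f0) * nhull = #|[set d in T | ~~ tri d & cls d == f]|)%N.
  case: (eqVneq f f0) => [->|ne].
    rewrite mul1n; apply: eq_card => d; rewrite !inE.
    case: (boolP (d \in T)) => //= dT; case: (boolP (tri d)) => //= nt.
    by rewrite cls_hull // eqxx.
  rewrite mul0n; apply/esym/eqP; rewrite cards_eq0; apply/eqP/setP => d; rewrite !inE.
  apply/negP => /and3P[dT nt /eqP e]; by rewrite -e cls_hull // eqxx in ne.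
rewrite !card_indicator -!big_split /=; apply: eq_bigr => d _; rewrite !inE.
have := @tri_T V X Y T planeT XY_inj d.
by case: (tri d); case: (d \in T); case: (orig d); case: (cls d == f) => //= h; have := h isT.
Qed.

(** The class contains its triangles as nodes, and also the node [None] if it is the outer one. *)
Lemma ntri_ndiag f : (ntri f + (f == f0) <= ndiag f + 1)%N.
Proof.
apply: leq_trans (G_size f).
pose S := [set d | tri d & (cls d == f) && special d].
have -> : ntri f = #|[set Some d | d in S]| by rewrite card_imset //; apply: Some_inj.
have sub : [set Some d | d in S] \subset [set w | G w == f] :\ None.
  apply/subsetP => w /imsetP[d]; rewrite inE => /and3P[td cd sd] ->.
  by rewrite !inE /= -(node_special td sd).
apply: (@leq_trans (#|[set w | G w == f] :\ None| + (f == f0))).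
  by rewrite leq_add2r subset_leq_card.
by rewrite [X in (_ <= X)%N](cardsD1 None) inE addnC leq_add2r eq_sym.
Qed.

(** Both sides of a bend may belong to the same class; the two wedges share no corner, so their
    angles add. *)
Lemma bend_corners f j : f <> f0 ->
  (if cls (pa j, bend j) == f then alpha else 0) +
  (if cls (pc j, bend j) == f then 2 * PI - alpha else 0) <=
  \rsum_(t | tri (bend j, t) && (cls (bend j, t) == f)) corner (bend j, t).
Proof.
move=> ff0; set b := bend j.
have ba : b <> pa j by exact: (T_irr planeT (paT j)).
have bc : b <> pc j by exact: (T_irr planeT (pcT j)).
pose P r x t := [&& tri (b, t), cls (b, t) == f & `[< Ang X Y b r t < Ang X Y b r x >]].
pose S r x := \rsum_(t | P r x t) corner (b, t).
have h1 : (if cls (pa j, b) == f then alpha else 0) <=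
   (if cls (pa j, b) == f then S (pc j) (pa j) else 0).
  case: eqP => e; last lra; rewrite -[X in X <= _](bend_angle j).
  apply: (wedge_angle planeT XY_inj cls_rot G_swap cls_hull (pcT j) (paT j)) => //.
  - by move=> z _ /orig_sym /orig_bend; tauto.
  - by rewrite bend_angle; have := alpha_pi; lra.
  - by rewrite cls_convex.
have h2 : (if cls (pc j, b) == f then 2 * PI - alpha else 0) <=
   (if cls (pc j, b) == f then S (pa j) (pc j) else 0).
  case: eqP => e; last lra; rewrite -[X in X <= _](reflex_angle j).
  apply: (wedge_angle planeT XY_inj cls_rot G_swap cls_hull (paT j) (pcT j)) => //.
  - by move=> z _ /orig_sym /orig_bend; tauto.
  - by rewrite reflex_angle; have := alpha_pi; lra.
  - by rewrite cls_reflex.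
apply: (Rle_trans _ _ _ (Rplus_le_compat _ _ _ _ h1 h2)).
have c0 t : 0 <= corner (b, t) by apply: corner_ge0.
have S0 r x : 0 <= S r x by apply: rsum_ge0.
have SQ r x : S r x <= \rsum_(t | tri (b, t) && (cls (b, t) == f)) corner (b, t).
  by apply: (@rsum_subset _ _ _ (fun t => corner (b, t))) => // t /and3P[-> ->].
have SS : S (pc j) (pa j) + S (pa j) (pc j) <= \rsum_(t | tri (b, t) && (cls (b, t) == f)) corner (b, t).
  apply: (@rsum_disjoint _ _ _ _ (fun t => corner (b, t))) => // t.
  - by case/and3P => -> ->.
  - by case/and3P => -> ->.
  case/and3P => tt _ /asboolP u1 /and3P[_ _ /asboolP u2].
  have bt := T_irr planeT (tri_T planeT XY_inj tt).
  have b1 := Ang_bound XY_inj ba bt; have b2 := Ang_bound XY_inj bc bt.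
  have e1 := bend_angle j; have e2 := reflex_angle j; rewrite -/b in e1 e2.
  by case: (AngD XY_inj bc ba bt); lra.
have := S0 (pc j) (pa j); have := S0 (pa j) (pc j); have := SQ (pc j) (pa j); have := SQ (pa j) (pc j).
case: eqP => _; case: eqP => _; lra.
Qed.

(** All corners of the class sum to [ntri f * PI]. The bends take the left side, and an end of a
    bounding edge, which is not a bend, has a positive corner in the class: hence the strict
    inequality. *)
Lemma class_angle f : f <> f0 -> (0 < nconv f + nrefl f)%N ->
  INR (nconv f) * alpha + INR (nrefl f) * (2 * PI - alpha) < INR (ntri f) * PI.
Proof.
move=> ff0 pos.
have tot : \rsum_(d | tri d && (cls d == f)) corner d = INR (ntri f) * PI.
  have := corner_total planeT XY_inj (Q := fun d => cls d == f).
  rewrite (special_third planeT XY_inj g_inj); last by move=> d td; rewrite cls_rot.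
  rewrite INR_muln -/(ntri f) => h.
  have {}h := h (fun d td => f_equal (fun w => w == f) (cls_rot td)).
  by have : INR 3 = 3 by [rewrite /=; lra]; move=> e; rewrite e in h; lra.
pose Fv v := \rsum_(t | tri (v, t) && (cls (v, t) == f)) corner (v, t).
have Fv0 v : 0 <= Fv v by apply: rsum_ge0 => t _; apply: corner_ge0.
have totv : \big[Rplus/0]_v Fv v = INR (ntri f) * PI.
  by rewrite -tot /Fv pair_big_dep /=; apply: eq_big => [[a b]|[a b] _].
have [v0 v0b Fv1] : exists2 v0, (forall j, v0 <> bend j) & 0 < Fv v0.
  have key p j : (p, bend j) \in T -> cls (p, bend j) = f -> 0 < Fv p.
    move=> pT cp.
    have tp : tri (p, bend j).
      by case: (boolP (tri (p, bend j))) => // nt; case: ff0; rewrite -cp; apply: cls_hull.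
    rewrite /Fv (bigD1 (bend j)) /=; last by rewrite tp cp eqxx.
    set S := \big[_/_]_(_ | _) _.
    have : 0 <= S by apply: rsum_ge0 => t _; apply: corner_ge0.
    by have := corner_pos planeT XY_inj tp; lra.
  move: pos; rewrite addn_gt0 => /orP[]; rewrite card_gt0 => /set0Pn[j]; rewrite inE => /eqP e.
    exists (pa j); first exact: pa_bend.
    exact: (key _ j (T_sym planeT (paT j)) e).
  exists (pc j); first exact: pc_bend.
  exact: (key _ j (T_sym planeT (pcT j)) e).
have hJ : \big[Rplus/0]_j Fv (bend j) + Fv v0 <= INR (ntri f) * PI.
  rewrite -totv -(big_pred1_eq Rplus v0 Fv).
  have -> : \big[Rplus/0]_j Fv (bend j) = \rsum_(v | v \in bend @: setT) Fv v.
    rewrite big_imset /=; last by move=> i j _ _; apply: bend_inj.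
    by apply: eq_bigl => j; rewrite inE.
  apply: (@rsum_disjoint _ _ _ xpredT) => // v /imsetP[j _ ->] /eqP e.
  by apply: (v0b j).
have hS : INR (nconv f) * alpha + INR (nrefl f) * (2 * PI - alpha) <= \big[Rplus/0]_j Fv (bend j).
  rewrite -!rsum_const big_mkcond [X in _ + X]big_mkcond -big_split /=.
  by apply: rsum_le => j _; apply: bend_corners.
lra.
Qed.

Lemma inner_class f : f <> f0 -> (3 * nrefl f + 2 * nconv f <= 2 * ntri f)%N.
Proof.
move=> ff0; have nf0 : (f == f0) = false by apply/eqP.
have := ndarts f; have := ntri_ndiag f; rewrite nf0 mul0n !addn0 => h1 h2.
apply: (inner_arith alpha_bound h2 h1) => pos; exact: class_angle.
Qed.

(* In the only case not settled by arithmetic, the outer class is bounded by the reflex side of a single edge; its bend would then be both the leftmost and the rightmost vertex. *)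
Lemma outer_class (j0 : J) : (3 * nrefl f0 + 2 * nconv f0 + 2 <= 2 * (ntri f0 + nhull))%N.
Proof.
have := ndarts f0; have := ntri_ndiag f0; rewrite eqxx mul1n => h1 h2.
have [M [m [Mm eM em hM hm]]] := extremes planeT g_inj (paT j0).
have s1 : (1 : R) = 1 \/ (1 : R) = -1 by left.
have s2 : (-1 : R) = 1 \/ (-1 : R) = -1 by right.
have [a aT na] := extreme_out planeT XY_inj s1 eM hM.
have [b bT nb] := extreme_in planeT XY_inj s1 eM hM.
have [a' aT' na'] := extreme_out planeT XY_inj s2 em hm.
have [b' bT' nb'] := extreme_in planeT XY_inj s2 em hm.
have hull2 : (2 <= nhull)%N.
  have -> : 2%N = #|[set (M, a); (b, M)]|.
    rewrite cards2 xpair_eqE; case: eqP => //= e; subst b.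
    by have := T_irr planeT bT.
  by apply: subset_leq_card; apply/subsetP => d; rewrite !inE => /orP[] /eqP ->; rewrite ?aT ?bT.
(* The counts give [t + h >= 2 (C + r)], which suffices once [r + 2 C >= 2]. What remains is [C = 0]
   with [r <= 1], and [r = 0] is settled by [hull2]. *)
case: (leqP 2 (nrefl f0 + 2 * nconv f0)) => small; first by lia.
have C0 : nconv f0 = 0%N by lia.
case: (boolP (ntri f0 + nhull == 2 * (nconv f0 + nrefl f0)))%N => [/eqP eq|ne]; last by move/eqP: ne; lia.
exfalso.
have r1 : nrefl f0 = 1%N by lia.
have d0 : ndiag f0 = 0%N by lia.
move/eqP: (r1); rewrite /nrefl => /cards1P[j ej].
have allf0 d : d \in T -> cls d = f0 -> d = (pc j, bend j) \/ d = (bend j, pa j).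
  move=> dT cd.
  have od : orig d.
    apply/negPn/negP => no; have := card_swap_diag f0; rewrite d0 muln0 => /eqP.
    by rewrite cards_eq0 => /eqP/setP/(_ d); rewrite !inE dT no cd eqxx.
  have refl i : cls (pc i, bend i) = f0 -> i = j.
    by move=> e; have : i \in [set j] by [rewrite -ej inE e]; rewrite inE => /eqP.
  have conv i : cls (pa i, bend i) <> f0.
    move=> e; move/eqP: C0; rewrite /nconv cards_eq0 => /eqP/setP/(_ i).
    by rewrite !inE e eqxx.
  case/codomP: od cd => -[i [s o]] ->; rewrite /half /=.
  case: s; case: o => cd.
  - by case: (conv i).
  - by right; rewrite cls_reflex in cd; rewrite (refl _ cd).
  - by left; rewrite (refl _ cd).
  by case: (conv i); rewrite -cls_convex.
have atbend v p q : (v, p) \in T -> ~~ tri (v, p) -> (q, v) \in T -> ~~ tri (q, v) -> v = bend j.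
  move=> vp nvp qv nqv.
  case: (allf0 _ vp (cls_hull vp nvp)) => -[e1 e2] //.
  case: (allf0 _ qv (cls_hull qv nqv)) => -[e3 e4] //.
  by case: (@pa_pc j); rewrite -e1 -e4.
by apply: Mm; rewrite (atbend _ _ _ aT na bT nb) (atbend _ _ _ aT' na' bT' nb').
Qed.

Lemma edge_count_classes (j0 : J) : (5 * #|J| + 6 <= 4 * #|V|)%N.
Proof.
have sR : (\sum_f nrefl f = #|J|)%N.
  have := sum_fibers (fun j => cls (pc j, bend j)) xpredT.
  by rewrite -[#|J|]cardsT => <-; apply: eq_bigr => f _; apply: eq_card => j; rewrite !inE.
have sC : (\sum_f nconv f = #|J|)%N.
  have := sum_fibers (fun j => cls (pa j, bend j)) xpredT.
  by rewrite -[#|J|]cardsT => <-; apply: eq_bigr => f _; apply: eq_card => j; rewrite !inE.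
have sT : (\sum_f ntri f = #|[set d | tri d && special d]|)%N.
  rewrite -(sum_fibers cls); apply: eq_bigr => f _; apply: eq_card => d; rewrite !inE.
  by rewrite -andbA; congr (_ && _); rewrite andbC.
have sp : (\sum_f ntri f + nhull = #|[set d in T | special d]|)%N.
  rewrite sT /nhull !card_indicator -big_split /=; apply: eq_bigr => d _; rewrite !inE.
  have := @tri_T V X Y T planeT XY_inj d; rewrite /tri /special.
  case: (third _ _ _ d) => [c|] /=; case: (d \in T) => // h; last by have := h isT.
  by rewrite addn0.
have := special_count planeT maxT XY_inj g_inj (paT j0); rewrite -sp.
have le : (\sum_f (3 * nrefl f + 2 * nconv f) + 2 <= \sum_f (2 * ntri f) + 2 * nhull)%N.
  rewrite (bigD1 f0) //= [X in (_ <= X + _)%N](bigD1 f0) //=.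
  have rest : (\sum_(f | f != f0) (3 * nrefl f + 2 * nconv f) <= \sum_(f | f != f0) (2 * ntri f))%N.
    by apply: leq_sum => f /eqP; apply: inner_class.
  rewrite [X in (X <= _)%N]addnAC [X in (_ <= X)%N]addnAC -mulnDr.
  exact: leq_add (outer_class j0) rest.
move: le; rewrite big_split /= -!big_distrr /= sR sC.
by move: (\sum_f ntri f)%N nhull #|J| #|V| => t h e v; lia.
Qed.

End Classes.

Lemma edge_count (j0 : J) : (5 * #|J| + 6 <= 4 * #|V|)%N.
Proof. by have [G [h1 h2]] := class_function; apply: (edge_count_classes h1 h2). Qed.

End Counting.

(** * From multigraphs to plane sets *)

(** Two vertices with equal images determine [eps] as a quotient of coordinate differences; the
    chosen value exceeds all such quotients. *)
Lemma generic_direction (V : finType) (X Y : V -> R) :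
  (forall p q, X p = X q -> Y p = Y q -> p = q) -> exists eps, injective (lin X Y eps).
Proof.
move=> XY_inj.
pose slope (d : V * V) := Rabs ((X d.2 - X d.1) / (Y d.1 - Y d.2)).
exists (1 + \big[Rplus/0]_d slope d) => p q; rewrite /lin; set S := \big[_/_]_d _ => e.
have le : slope (p, q) <= S.
  rewrite /S (bigD1 (p, q)) //=; set S' := \big[_/_]_(_ | _) _.
  have : 0 <= S' by apply: rsum_ge0 => d _; apply: Rabs_pos.
  lra.
case: (Req_dec (Y p) (Y q)) => ey.
  by apply: XY_inj => //; rewrite ey in e; lra.
exfalso; have : (X q - X p) / (Y p - Y q) = 1 + S.
  apply: (Rmult_eq_reg_r (Y p - Y q)); last lra.
  by have -> : (X q - X p) / (Y p - Y q) * (Y p - Y q) = X q - X p by [field; lra]; lra.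
move=> es; move: le; rewrite /slope /= es.
have := Rle_abs (1 + S); lra.
Qed.

Lemma maximal_plane_set (V : finType) (X Y : V -> R) (T0 : {set V * V}) : plane_set X Y T0 ->
  exists T, [/\ plane_set X Y T, T0 \subset T &
    forall T', plane_set X Y T' -> T \subset T' -> T' = T].
Proof.
move=> h0; pose Q := fun T : {set V * V} => `[< plane_set X Y T >] && (T0 \subset T).
have Q0 : Q T0 by rewrite /Q subxx andbT; apply/asboolP.
case: (arg_maxnP (fun T : {set V * V} => #|T|) Q0) => T /andP[/asboolP hT sT] Tmax.
exists T; split=> // T' hT' TT'; apply/esym/eqP; rewrite eqEcard TT' /=; apply: Tmax.
by rewrite /Q (subset_trans sT TT') andbT; apply/asboolP.
Qed.

Lemma xing_point (V : finType) (X Y : V -> R) a b c d : xing X Y a b c d ->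
  exists s t, [/\ 0 < s < 1, 0 < t < 1,
    X a + s * (X b - X a) = X c + t * (X d - X c) &
    Y a + s * (Y b - Y a) = Y c + t * (Y d - Y c)].
Proof.
have ratio u v : u * v < 0 -> 0 < u / (u - v) < 1.
  move=> h; have h1 : 0 < (u - v) * (u - v) by nra.
  have h2 : u - v <> 0 by move=> e; rewrite e in h1; lra.
  have -> : u / (u - v) = (u * (u - v)) / ((u - v) * (u - v)) by field.
  split; first by apply: Rdiv_lt_0_compat; nra.
  apply: (Rmult_lt_reg_r ((u - v) * (u - v))) => //.
  have -> : u * (u - v) / ((u - v) * (u - v)) * ((u - v) * (u - v)) = u * (u - v) by field.
  nra.
case=> h1 h2; have hs := ratio _ _ h2; have ht := ratio _ _ h1.
(* Orientation with respect to a fixed line is affine along a segment, which locates its zero from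
   the values at the ends. *)
exists (cr X Y c d a / (cr X Y c d a - cr X Y c d b)), (cr X Y a b c / (cr X Y a b c - cr X Y a b d)).
have D : cr X Y a b c - cr X Y a b d = - (cr X Y c d a - cr X Y c d b).
  by rewrite /cr /det3; ring.
have D0 : cr X Y c d a - cr X Y c d b <> 0.
  by move=> e; rewrite e /Rdiv Rinv_0 in hs; lra.
split=> //; rewrite D.
  apply: (Rmult_eq_reg_r (cr X Y c d a - cr X Y c d b)) => //.
  transitivity (X a * (cr X Y c d a - cr X Y c d b) + cr X Y c d a * (X b - X a)); first by field.
  transitivity (X c * (cr X Y c d a - cr X Y c d b) - cr X Y a b c * (X d - X c)); last by field; lra.
  by rewrite /cr /det3; ring.
apply: (Rmult_eq_reg_r (cr X Y c d a - cr X Y c d b)) => //.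
transitivity (Y a * (cr X Y c d a - cr X Y c d b) + cr X Y c d a * (Y b - Y a)); first by field.
transitivity (Y c * (cr X Y c d a - cr X Y c d b) - cr X Y a b c * (Y d - Y c)); last by field; lra.
by rewrite /cr /det3; ring.
Qed.

Section Multigraph.

Variables (alpha : R) (P : list point) (E : list edge) (d0 : edge).
Hypothesis alpha_bound : 0 < alpha <= 2 * PI / 3.
Hypothesis graph : alpha_bend_multigraph alpha P E.

Local Notation n := (length P).
Local Notation J := 'I_(length E).
Local Notation V := ('I_n + J)%type.

Let ed (j : J) := List.nth j E d0.
Let vx (i : 'I_n) := List.nth i P (0, 0).

Definition place (v : V) : point := match v with inl i => vx i | inr j => e_b (ed j) end.
Let X v := fst (place v).
Let Y v := snd (place v).

Lemma ed_In j : In (ed j) E.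
Proof. by apply: nth_In; apply/ltP. Qed.

Lemma ed_bend j : alpha_bend_edge alpha (ed j).
Proof. by have [_ [h _]] := graph; case: (h _ (ed_In j)). Qed.

Lemma ed_disjoint i j x : i <> j -> on_edge (ed i) x -> on_edge (ed j) x ->
  is_endpoint (ed i) x /\ is_endpoint (ed j) x.
Proof.
move=> ij; have [_ [_ [_ h]]] := graph; apply: h; [exact/ltP | exact/ltP | by move/val_inj].
Qed.

Lemma vx_endpoint j i : on_edge (ed j) (vx i) -> is_endpoint (ed j) (vx i).
Proof.
have [_ [_ [h _]]] := graph; apply: h; first exact: ed_In.
by apply: nth_In; apply/ltP.
Qed.

Lemma bend_on_edge j : on_edge (ed j) (e_b (ed j)).
Proof. by right; exists 0; split; [lra | case: (e_b _) => x y /=; congr pair; ring]. Qed.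

Lemma bend_not_endpoint j : ~ is_endpoint (ed j) (e_b (ed j)).
Proof.
have [_ [nc _]] := ed_bend j.
by case=> e; apply: nc; rewrite /collinear e; ring.
Qed.

(** A bend lies on its edge without being an end of it; meeting a point of [P] or another bend would
    contradict one of the contact conditions of the multigraph. *)
Lemma place_inj p q : X p = X q -> Y p = Y q -> p = q.
Proof.
move=> eX eY; have {eX eY} : place p = place q.
  by move: eX eY; rewrite /X /Y; case: (place p) (place q) => [a b] [c d] /= -> ->.
case: p q => [i|i] [j|j] /= e.
- congr inl; apply: val_inj; have [nd _] := graph.
  exact: (proj1 (NoDup_nth P (0, 0)) nd i j (elimT ltP (ltn_ord i)) (elimT ltP (ltn_ord j)) e).
- by case: (@bend_not_endpoint j); rewrite -e; apply: vx_endpoint; rewrite e; apply: bend_on_edge.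
- by case: (@bend_not_endpoint i); rewrite e; apply: vx_endpoint; rewrite -e; apply: bend_on_edge.
case: (EM (i = j)) => [-> //|ij]; case: (@bend_not_endpoint i).
have on : on_edge (ed j) (e_b (ed i)) by rewrite e; apply: bend_on_edge.
by case: (ed_disjoint ij (bend_on_edge i) on).
Qed.

(** The given order of the ends is arbitrary; it is fixed here so that every edge turns left at its
    bend. *)
Definition ccw_ends (j : J) (p : 'I_n * 'I_n) : Prop :=
  (vx p.1 = e_a (ed j) /\ vx p.2 = e_c (ed j) \/ vx p.1 = e_c (ed j) /\ vx p.2 = e_a (ed j)) /\
  0 < cr X Y (inl p.1) (inr j) (inl p.2).

Lemma ex_ccw_ends : exists f : J -> 'I_n * 'I_n, forall j, ccw_ends j (f j).
Proof.
apply: (@fin_all_exists _ (fun=> ('I_n * 'I_n)%type) ccw_ends) => j.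
have [_ [h _]] := graph; have [_ [ha hc]] := h _ (ed_In j).
have [_ [nc _]] := ed_bend j.
have idx p : In p P -> exists i : 'I_n, vx i = p.
  by move/(In_nth _ _ (0, 0)) => [k [/ltP kn <-]]; exists (Ordinal kn).
have [i ei] := idx _ ha; have [k ek] := idx _ hc.
pose c := cr X Y (inl i) (inr j) (inl k).
case: (Rtotal_order c 0) => [lt|[e|gt]].
- exists (k, i); split; first by right.
  by rewrite /= -cr_rot cr_opp -/c; lra.
- by exfalso; apply: nc; move: e; rewrite /c /cr /det3 /X /Y /= ei ek.
by exists (i, k); split; [left | exact: gt].
Qed.

Section Halves.

Variable f : J -> 'I_n * 'I_n.
Hypothesis fP : forall j, ccw_ends j (f j).

Definition bend (j : J) : V := inr j.
Definition pa (j : J) : V := inl (f j).1.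
Definition pc (j : J) : V := inl (f j).2.

Lemma half_ccw j : 0 < cr X Y (pa j) (bend j) (pc j).
Proof. by case: (fP j). Qed.

Lemma half_angle j : Ang X Y (bend j) (pc j) (pa j) = alpha.
Proof.
have D := half_ccw j; have D' : 0 < cr X Y (bend j) (pc j) (pa j) by rewrite cr_rot.
have [e _] := fP j; have [_ [_ <-]] := ed_bend j.
rewrite /Ang arg_acos; last lra.
rewrite lagrange /angle_at; congr acos; congr (_ / _).
  rewrite /dt /X /Y /dot /vsub /pa /pc /bend /=; case: e => -[-> ->] /=; ring.
rewrite sqrt_mult_alt; last by apply: Rlt_le; apply: (dt_pos place_inj) => e1; rewrite e1 crxx in D'; lra.
rewrite /norm /dot /vsub /dt /X /Y /pa /pc /bend /=; case: e => -[-> ->] //=; exact: Rmult_comm.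
Qed.

Definition is_half (j : J) (p : V) : Prop := p = pa j \/ p = pc j.

(** Since the edge is not straight, an interior point of one half avoids the far end of the other
    half, besides the two ends of its own half. *)
Lemma half_open j p s x : is_half j p -> 0 < s < 1 ->
  fst x = X (bend j) + s * (X p - X (bend j)) -> snd x = Y (bend j) + s * (Y p - Y (bend j)) ->
  [/\ on_edge (ed j) x, ~ is_endpoint (ed j) x & x <> place (bend j)].
Proof.
move=> hp hs ex ey; have D := half_ccw j; have [e _] := fP j.
have xE : x = (X (bend j) + s * (X p - X (bend j)), Y (bend j) + s * (Y p - Y (bend j))).
  by rewrite -ex -ey; case: (x).
have key q o : (q = pa j /\ o = pc j) \/ (q = pc j /\ o = pa j) -> 0 <= s ->
    fst x = X (bend j) + s * (X q - X (bend j)) -> snd x = Y (bend j) + s * (Y q - Y (bend j)) ->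
    [/\ x <> place q, x <> place o & x <> place (bend j)].
  move=> hqo _ fx fy.
  have Dqo : cr X Y q (bend j) o <> 0.
    case: hqo => -[-> ->]; first lra.
    by rewrite -cr_rot cr_opp; lra.
  split=> xe; apply: Dqo.
  - have h1 : X q = X (bend j) + s * (X q - X (bend j)) by rewrite -fx xe.
    have h2 : Y q = Y (bend j) + s * (Y q - Y (bend j)) by rewrite -fy xe.
    have h1' : X q - X (bend j) = 0 by apply: (Rmult_eq_reg_l (1 - s)); lra.
    have h2' : Y q - Y (bend j) = 0 by apply: (Rmult_eq_reg_l (1 - s)); lra.
    rewrite /cr /det3; have -> : X (bend j) = X q by lra.
    have -> : Y (bend j) = Y q by lra.
    ring.
  - have h1 : X o = X (bend j) + s * (X q - X (bend j)) by rewrite -fx xe.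
    have h2 : Y o = Y (bend j) + s * (Y q - Y (bend j)) by rewrite -fy xe.
    by rewrite /cr /det3 h1 h2; ring.
  have h1 : X (bend j) = X (bend j) + s * (X q - X (bend j)) by rewrite -{1}fx xe.
  have h2 : Y (bend j) = Y (bend j) + s * (Y q - Y (bend j)) by rewrite -{1}fy xe.
  have h1' : X q - X (bend j) = 0 by apply: (Rmult_eq_reg_l s); lra.
  have h2' : Y q - Y (bend j) = 0 by apply: (Rmult_eq_reg_l s); lra.
  rewrite /cr /det3; have -> : X (bend j) = X q by lra.
  have -> : Y (bend j) = Y q by lra.
  ring.
have seg : on_edge (ed j) x.
  have [o1 o2] : on_segment (place (bend j)) (place p) x /\ on_segment (place p) (place (bend j)) x.
    split; [exists s | exists (1 - s)]; split; try lra; rewrite xE /X /Y /=; congr pair; ring.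
  case: hp => hp; subst p; case: e => -[e1 e2].
  - by left; rewrite -e1.
  - by right; rewrite -e1.
  - by right; rewrite -e2.
  - by left; rewrite -e2.
have s0 : 0 <= s by lra.
have [ne1 ne2 ne3] : [/\ x <> e_a (ed j), x <> e_c (ed j) & x <> place (bend j)].
  case: hp => hp; subst p.
    have [k1 k2 k3] := key _ _ (or_introl (conj erefl erefl)) s0 ex ey.
    by case: e => -[e1 e2]; rewrite -e1 -e2.
  have [k1 k2 k3] := key _ _ (or_intror (conj erefl erefl)) s0 ex ey.
  by case: e => -[e1 e2]; rewrite -e1 -e2.
by split=> //; case.
Qed.

Lemma half_btw j p v : is_half j p -> ~ btw X Y (bend j) p v.
Proof.
move=> hp [s [hs ex ey]]; have [on ne nb] := half_open hp hs ex ey.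
case: v ex ey on ne nb => [i|k] ex ey on ne nb; first by apply: ne; apply: vx_endpoint.
case: (EM (j = k)) => [e|jk]; first by apply: nb; rewrite e.
by apply: ne; case: (ed_disjoint jk on (bend_on_edge k)).
Qed.

Lemma half_xing j p k q : is_half j p -> is_half k q -> ~ xing X Y (bend j) p (bend k) q.
Proof.
move=> hp hq hx; case: (EM (j = k)) => [e|jk].
  by move: hx; rewrite e /xing crxyx; lra.
have [s [t [hs ht ex ey]]] := xing_point hx.
pose x := (X (bend j) + s * (X p - X (bend j)), Y (bend j) + s * (Y p - Y (bend j))).
have [on ne _] := @half_open j p s x hp hs erefl erefl.
have [on' _ _] := @half_open k q t x hq ht ex ey.
by apply: ne; case: (ed_disjoint jk on on').
Qed.

Definition halves : {set V * V} :=
  [set d | `[< exists j p, is_half j p /\ (d = (bend j, p) \/ d = (p, bend j)) >]].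

Lemma halves_ind (Q : V -> V -> Prop) : (forall a b, Q a b -> Q b a) ->
  (forall j p, is_half j p -> Q (bend j) p) -> forall a b, (a, b) \in halves -> Q a b.
Proof.
move=> Qs Qh a b; rewrite inE => /asboolP[j [p [hp]]].
by case=> -[-> ->]; [|apply: Qs]; apply: Qh.
Qed.

Lemma halvesP j p : is_half j p -> (bend j, p) \in halves.
Proof. by move=> h; rewrite inE; apply/asboolP; exists j, p; split=> //; left. Qed.

Lemma halves_plane : plane_set X Y halves.
Proof.
split.
- move=> a b; rewrite !inE => /asboolP[j [p [hp h]]]; apply/asboolP; exists j, p; split=> //.
  by case: h => -[-> ->]; [right|left].
- move=> a; apply/negP => h; suff : a <> a by [].
  apply: (halves_ind (Q := fun x y => x <> y)) h => [x y xy yx|j p hp]; first by apply: xy.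
  by case: hp => ->.
- move=> a b p h; move: p; apply: (halves_ind (Q := fun x y => forall p, ~ btw X Y x y p)) h.
    by move=> x y h p /btwC; apply: h.
  by move=> j q hq p; apply: half_btw.
move=> a b c d h h'; apply: (halves_ind (Q := fun x y => ~ xing X Y x y c d)) h.
  by move=> x y xy /xingN.
move=> j p hp; apply: (halves_ind (Q := fun x y => ~ xing X Y (bend j) p x y)) h'.
  by move=> x y xy /xingC /xingN /xingC.
by move=> k q hq; apply: half_xing.
Qed.

End Halves.

Lemma multigraph_bound : (0 < length E)%N -> (length E + 6 <= 4 * n)%N.
Proof.
move=> E0; pose j0 : J := Ordinal E0.
have [f fP] := ex_ccw_ends.
have [eps g_inj] := generic_direction place_inj.
have [T [planeT sub maxT]] := maximal_plane_set (halves_plane fP).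
have inT j p : is_half f j p -> (bend j, p) \in T.
  by move=> h; apply: (subsetP sub); apply: halvesP.
have := @edge_count V X Y T planeT maxT place_inj eps g_inj J bend (pa f) (pc f) alpha alpha_bound
  _ _ _ (fun j => inT j _ (or_introl erefl)) (fun j => inT j _ (or_intror erefl))
  (half_ccw fP) (half_angle fP) j0.
rewrite card_sum !card_ord => h.
(* The vertices of the drawing are the points and the bends, [n + length E] in number. *)
suff : (5 * length E + 6 <= 4 * (n + length E))%N by lia.
by apply: h => // i j [].
Qed.

End Multigraph.

(** The [edge] argument supplies the default value for [nth]. *)
Lemma multigraph_bound_INR alpha P E : 0 < alpha <= 2 * PI / 3 -> alpha_bend_multigraph alpha P E ->
  edge -> (0 < length E)%coq_nat -> INR (length E) <= 4 * INR (length P) - 6.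
Proof.
move=> alpha_bound graph d0 /ltP E0.
have /leP /le_INR := multigraph_bound d0 alpha_bound graph E0.
rewrite INR_addn INR_muln /=; lra.
Qed.

End AlphaBend.

Theorem theorem11 (alpha : R) (n : nat) (P : list point) (E : list edge) :
  0 < alpha <= 2 * PI / 3 -> (2 <= n)%nat -> length P = n ->
  alpha_bend_multigraph alpha P E ->
  INR (length E) <= 4 * INR n - 6.
Proof.
intros alpha_bound n2 <- graph.
destruct E as [|e E'].
  (* With no edge the claim is [0 <= 4 n - 6], where [2 <= n] is used. *)
  apply le_INR in n2; simpl in *; Lra.lra.
pose proof (AlphaBend.multigraph_bound_INR alpha_bound graph e) as H.
apply H; simpl; apply PeanoNat.Nat.lt_0_succ.
Qed.
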